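(* Let $I$ be an index set and let $a_{\alpha,\beta},b_{\alpha,\beta}^{\gamma},c_{\alpha,\beta}^{\gamma},d_{\alpha,\beta}^{\gamma}\in\mathbb{R}$ for $\alpha,\beta,\gamma\in I$, where for each pair $(\alpha,\beta)$ only finitely many of $b_{\alpha,\beta}^{\gamma},c_{\alpha,\beta}^{\gamma},d_{\alpha,\beta}^{\gamma}$ ($\gamma\in I$) are nonzero. Let $H:\Omega\to\mathcal{L}$ be the matrix differential operator of type $1$ given by $$H^1_{\alpha,\beta}=H^0_{\alpha,\beta}=a_{\alpha,\beta}D^5+\sum_{\gamma\in I}\left[b^{\gamma}_{\alpha,\beta}\Phi_{\gamma}D^2+c_{\alpha,\beta}^{\gamma}\Phi_{\gamma}(2)D+d_{\alpha,\beta}^{\gamma}\Phi_{\gamma}(3)\right]\qquad(\alpha,\beta\in I).$$ Let $V=\sum_{\alpha\in I}\mathbb{R}\Phi_\alpha$ be the vector space with basis $\{\Phi_\alpha\mid\alpha\in I\}$, and define bilinear operations $\cdot,\times,\circ$ on $V$ and a bilinear form $\langle\cdot,\cdot\rangle$ on $V$ by $$\Phi_{\alpha}\cdot \Phi_{\beta}=\sum_{\gamma\in I}b_{\alpha,\beta}^{\gamma}\Phi_{\gamma},\quad \Phi_{\alpha}\times \Phi_{\beta}=\sum_{\gamma\in I}c_{\alpha,\beta}^{\gamma}\Phi_{\gamma},\quad \Phi_{\alpha}\circ \Phi_{\beta}=\sum_{\gamma\in I}d_{\alpha,\beta}^{\gamma}\Phi_{\gamma},\quad \langle \Phi_{\alpha},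 \Phi_{\beta}\rangle=a_{\alpha,\beta}.$$ Then $H$ is a Hamiltonian operator (Hamiltonian superoperator) if and only if all of the following hold: $(V,\circ,\times)$ is an NX-bialgebra; $$u\cdot v=u\circ v+v\circ u-u\times v\qquad\text{for all }u,v\in V;$$ and $\langle\cdot,\cdot\rangle$ is a symmetric bilinear form satisfying $$\langle u\circ v,w\rangle=\langle u,v\circ w\rangle =2\langle u\times v,w\rangle\qquad\text{for all }u,v,w\in V.$$
   Context: All vector spaces are over $\mathbb{R}$; $\mathbb{N}=\{0,1,2,\dots\}$, $\mathbb{N}^+=\mathbb{N}\setminus\{0\}$. Indices of $\mathbb{Z}_2$-gradings are read mod 2. When a homogeneous element of a $\mathbb{Z}_2$-graded space (or a homogeneous map) appears in an exponent of $-1$, it stands for its parity; formulas are extended linearly. **Algebras.** A Novikov algebra is a vector space with a bilinear operation $\circ$ satisfying $(x\circ y)\circ z=(x\circ z)\circ y$ and $(x\circ y)\circ z-x\circ (y\circ z)=(y\circ x)\circ z-y\circ (x\circ z)$ for all $x,y,z$. An NX-bialgebra is a vector space $V$ with two bilinear operations $\times,\circ$ such that $(V,\times)$ is a commutative (not necessarily associative) algebra, $(V,\circ)$ is a Novikov algebra, and for all $u,v,w\in V$: $$(u\times v)\circ w=u\times (v\circ w),$$ $$(u\times v)\times w+u\times (v\times w)=(v\circ u)\times w+u\times (v\circ w)-v\circ (u\times w),$$ $$(u\times v)\times w-u\times (v\times w)=(u\times v)\circ w+w\circ (u\times v)-u\circ (v\times w)-(v\times w)\circ u.$$ **The formal calculus.**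 Let $\mathcal{A}$ be the unital associative $\mathbb{R}$-algebra generated by formal variables $\Phi_i(n)$ ($i\in I$, $n\in\mathbb{N}^+$) subject only to $\Phi_i(m)\Phi_j(n)=(-1)^{mn}\Phi_j(n)\Phi_i(m)$; write $\Phi_i=\Phi_i(1)$. It is $\mathbb{Z}_2$-graded, $\mathcal{A}=\mathcal{A}_0\oplus\mathcal{A}_1$, with $\Phi_i(n)$ of parity $n$ mod 2. Let $\partial_{\Phi_j(l)}$ be the superderivation of $\mathcal A$ of parity $l$ with $\partial_{\Phi_j(l)}(\Phi_p(q))=\delta_{j,p}\delta_{l,q}$, i.e. $\partial_{\Phi_j(l)}(uv)=\partial_{\Phi_j(l)}(u)v+(-1)^{lu}u\,\partial_{\Phi_j(l)}(v)$. Let $D$ be the odd superderivation with $D(\Phi_i(n))=\Phi_i(n+1)$, so $D(uv)=D(u)v+(-1)^{u}uD(v)$. Let $\mathcal{L}=\mathcal{A}^I=\mathcal{L}_0\oplus\mathcal{L}_1$ with $\mathcal{L}_s=(\mathcal{A}_{s+1})^I$. For $\bar u=\{u_i\}_{i\in I}\in\mathcal{L}_s$ put $\partial_{\bar u}=\sum_{j\in I}\sum_{n\in\mathbb{N}}(-1)^{sn}D^n(u_j)\partial_{\Phi_j(n+1)}$ (a superderivation of $\mathcal{A}$ of parity $s$, supercommuting with $D$). $\mathcal{L}$ is a Lie superalgebra with bracket $[\bar u,\bar v]=\{\partial_{\bar u}(v_q)-(-1)^{\bar u\bar v}\partial_{\bar v}(u_q)\}_{q\in I}$, so that $[\partial_{\bar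 u},\partial_{\bar v}]=\partial_{[\bar u,\bar v]}$. Let $\tilde{\mathcal{A}}=\mathcal{A}/D(\mathcal{A})$, with $w\mapsto\tilde w$ the quotient map; $\mathcal{L}$ acts on $\tilde{\mathcal{A}}$ by $\bar u(\tilde w)=(\partial_{\bar u}(w))^{\sim}$. Let $\Omega=\{\bar\xi=\{\xi_i\}\in\mathcal{A}^I\mid\text{only finitely many }\xi_i\ne0\}$, with $\Omega_i=\Omega\cap\mathcal{L}_i$ for $i\in\mathbb{Z}_2$; each $\bar\xi\in\Omega$ defines a linear map $\mathcal{L}\to\tilde{\mathcal{A}}$ by $\bar\xi(\bar u)=\sum_{i\in I}(u_i\xi_i)^{\sim}$. **Matrix differential operators.** For $\iota\in\mathbb{Z}_2$, a matrix differential operator of type $\iota$ is a linear map $H:\Omega\to\mathcal{L}$ with, for $\bar\xi\in\Omega_i$ ($i\in\mathbb{Z}_2$), $(H\bar\xi)_p=\sum_{q\in I}H^i_{p,q}\xi_q$, where $H^i_{p,q}=\sum_{l=0}^{n(i,p,q)}a^i_{p,q,l}D^l$ with $a^i_{p,q,l}\in\mathcal{A}_{\iota+l}$. It maps $\Omega_i$ to $\mathcal{L}_{i+\iota}$. **Hamiltonian superoperators.** $H$ is super skew-symmetric if $\bar\xi_1(H\bar\xi_2)=-(-1)^{(H\bar\xi_1)(H\bar\xi_2)}\bar\xi_2(H\bar\xi_1)$ for all homogeneous $\bar\xi_1,\bar\xi_2\in\Omega$, where $H\bar\xi_k$ in the exponent has parity $\bar\xi_k+\iota$. In this case a 2-form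 $\omega_H$ (of parity $\iota$) on $\mathrm{Im}\,H$ with values in $\tilde{\mathcal{A}}$ is defined by $\omega_H(H\bar\xi_1,H\bar\xi_2)=\bar\xi_2(H\bar\xi_1)$. $H$ is a Hamiltonian superoperator (Hamiltonian operator) if it is super skew-symmetric, (a) $\mathrm{Im}\,H$ is a subalgebra of $\mathcal{L}$, and (b) $\omega=\omega_H$ is closed on $H(\Omega)$, i.e. $d\omega=0$, where for homogeneous $x_1,x_2,x_3\in \mathrm{Im}\,H$ $$d\omega(x_1,x_2,x_3)=\sum_{i=1}^{3}(-1)^{i+1+(\omega+x_1+\cdots+ x_{i-1})x_i}x_i\big(\omega(x_1,..,\check{x}_i,..,x_3)\big)+\sum_{i<j}(-1)^{i+j+(x_1+\cdots +x_{i-1})x_i+(x_1+\cdots +\check{x}_i+\cdots+ x_{j-1})x_j}\omega([x_i,x_j],x_1,..,\check{x}_i,..,\check{x}_j,..,x_3),$$ with $\check{x}$ denoting omission.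
   Formalization: In dω the parity of ω is left out of the exponents of the first sum (the factor (-1)^{ω x_i} is dropped); with the printed sign and ω_H of parity 1 the equivalence fails, e.g. for H = 2ΦD²+Φ(3) with I a single point. *)

(* Defs.v *)
From HB Require Import structures.
From mathcomp Require Import all_boot all_order all_algebra.
From mathcomp Require Import finmap.
From mathcomp Require Import boolp classical_sets functions cardinality fsbigop.
From mathcomp Require Import reals.
From mathcomp Require Export freeg.

Set Implicit Arguments.
Unset Strict Implicit.
Unset Printing Implicit Defensive.

Import GRing.Theory Num.Theory.

Local Open Scope ring_scope.
Local Open Scope quotient_scope.
Local Open Scope classical_set_scope.

Section Presentation.
Variables (R : realType) (I : choiceType).

(* Generators are numbered from 0 here: TGen i n is the letter Phi_i(n+1). *)
Inductive term : Type :=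
  | TConst of R
  | TGen of I & nat
  | TAdd of term & term
  | TMul of term & term.

HB.instance Definition _ := gen_eqMixin term.
HB.instance Definition _ := gen_choiceMixin term.

(* The least congruence making terms a unital associative R-algebra in which
   Phi_i(m) Phi_j(n) = (-1)^(mn) Phi_j(n) Phi_i(m). *)
Inductive term_eq : term -> term -> Prop :=
  | TE_refl x : term_eq x x
  | TE_sym x y : term_eq x y -> term_eq y x
  | TE_trans x y z : term_eq x y -> term_eq y z -> term_eq x z
  | TE_add x x' y y' : term_eq x x' -> term_eq y y' ->
      term_eq (TAdd x y) (TAdd x' y')
  | TE_mul x x' y y' : term_eq x x' -> term_eq y y' ->
      term_eq (TMul x y) (TMul x' y')
  | TE_addA x y z : term_eq (TAdd x (TAdd y z)) (TAdd (TAdd x y) z)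
  | TE_addC x y : term_eq (TAdd x y) (TAdd y x)
  | TE_add0 x : term_eq (TAdd (TConst 0) x) x
  | TE_addN x : term_eq (TAdd (TMul (TConst (-1)) x) x) (TConst 0)
  | TE_mulA x y z : term_eq (TMul x (TMul y z)) (TMul (TMul x y) z)
  | TE_mul1 x : term_eq (TMul (TConst 1) x) x
  | TE_mulDl x y z : term_eq (TMul (TAdd x y) z) (TAdd (TMul x z) (TMul y z))
  | TE_mulDr x y z : term_eq (TMul x (TAdd y z)) (TAdd (TMul x y) (TMul x z))
  | TE_constD r s : term_eq (TAdd (TConst r) (TConst s)) (TConst (r + s))
  | TE_constM r s : term_eq (TMul (TConst r) (TConst s)) (TConst (r * s))
  | TE_constC r x : term_eq (TMul (TConst r) x) (TMul x (TConst r))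
  | TE_gen i m j n : term_eq (TMul (TGen i m) (TGen j n))
      (TMul (TConst ((-1) ^+ (m.+1 * n.+1))) (TMul (TGen j n) (TGen i m))).

Definition term_eqb (x y : term) : bool := `[< term_eq x y >].

Lemma term_eqb_refl : reflexive term_eqb.
Proof. by move=> x; apply/asboolP; exact: TE_refl. Qed.

Lemma term_eqb_sym : symmetric term_eqb.
Proof. by move=> x y; apply/asboolP/asboolP; exact: TE_sym. Qed.

Lemma term_eqb_trans : transitive term_eqb.
Proof.
by move=> y x z /asboolP xy /asboolP yz; apply/asboolP; exact: TE_trans yz.
Qed.

Canonical term_equiv :=
  EquivRel term_eqb term_eqb_refl term_eqb_sym term_eqb_trans.

Definition superalg : Type := {eq_quot term_eqb}.
HB.instance Definition _ : EqQuotient term term_eqb superalg :=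
  EqQuotient.on superalg.
HB.instance Definition _ := Choice.on superalg.

Definition cls (t : term) : superalg := \pi_superalg t.

Lemma clsP s t : cls s = cls t <-> term_eq s t.
Proof.
split => [/eqmodP/asboolP //|st].
by apply/eqmodP/asboolP.
Qed.

Lemma cls_ind (P : superalg -> Prop) : (forall t, P (cls t)) -> forall x, P x.
Proof. by move=> Pc; elim/quotW. Qed.

Lemma repr_cls t : term_eq (repr (cls t)) t.
Proof. by apply/clsP; rewrite /cls reprK. Qed.

Definition sadd (x y : superalg) := cls (TAdd (repr x) (repr y)).
Definition smul (x y : superalg) := cls (TMul (repr x) (repr y)).
Definition sopp (x : superalg) := cls (TMul (TConst (-1)) (repr x)).
Definition sscale (r : R) (x : superalg) := cls (TMul (TConst r) (repr x)).

Lemma cls_add s t : cls (TAdd s t) = sadd (cls s) (cls t).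
Proof. by apply/clsP/TE_add; apply: TE_sym; exact: repr_cls. Qed.

Lemma cls_mul s t : cls (TMul s t) = smul (cls s) (cls t).
Proof. by apply/clsP/TE_mul; apply: TE_sym; exact: repr_cls. Qed.

Lemma cls_scale r t : cls (TMul (TConst r) t) = sscale r (cls t).
Proof.
by apply/clsP/TE_mul; [exact: TE_refl | apply: TE_sym; exact: repr_cls].
Qed.

Lemma saddA : associative sadd.
Proof.
elim/cls_ind => x; elim/cls_ind => y; elim/cls_ind => z.
by rewrite -!cls_add; apply/clsP/TE_addA.
Qed.

Lemma saddC : commutative sadd.
Proof.
by elim/cls_ind => x; elim/cls_ind => y; rewrite -!cls_add; apply/clsP/TE_addC.
Qed.

Lemma sadd0 : left_id (cls (TConst 0)) sadd.
Proof. by elim/cls_ind => x; rewrite -cls_add; apply/clsP/TE_add0. Qed.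

Lemma saddN : left_inverse (cls (TConst 0)) sopp sadd.
Proof.
elim/cls_ind => x.
by rewrite [sopp _](esym (cls_scale _ _)) -cls_add; apply/clsP/TE_addN.
Qed.

HB.instance Definition _ :=
  GRing.isZmodule.Build superalg saddA saddC sadd0 saddN.

Lemma smulA : associative smul.
Proof.
elim/cls_ind => x; elim/cls_ind => y; elim/cls_ind => z.
by rewrite -!cls_mul; apply/clsP/TE_mulA.
Qed.

Lemma smul1l : left_id (cls (TConst 1)) smul.
Proof. by elim/cls_ind => x; rewrite -cls_mul; apply/clsP/TE_mul1. Qed.

Lemma smul1r : right_id (cls (TConst 1)) smul.
Proof.
elim/cls_ind => x; rewrite -cls_mul; apply/clsP.
exact: TE_trans (TE_sym (TE_constC _ _)) (TE_mul1 _).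
Qed.

Lemma smulDl : left_distributive smul +%R.
Proof.
elim/cls_ind => x; elim/cls_ind => y; elim/cls_ind => z.
rewrite -[cls x + _]cls_add -!cls_mul -[RHS]cls_add.
by apply/clsP/TE_mulDl.
Qed.

Lemma smulDr : right_distributive smul +%R.
Proof.
elim/cls_ind => x; elim/cls_ind => y; elim/cls_ind => z.
rewrite -[cls y + _]cls_add -!cls_mul -[RHS]cls_add.
by apply/clsP/TE_mulDr.
Qed.

Fixpoint taug (t : term) : R := match t with
  | TConst r => r
  | TGen _ _ => 0
  | TAdd x y => taug x + taug y
  | TMul x y => taug x * taug y
  end.

Lemma taug_eq s t : term_eq s t -> taug s = taug t.
Proof.
elim=> //=.
- by move=> x y z _ -> _ ->.
- by move=> x x' y y' _ -> _ ->.
- by move=> x x' y y' _ -> _ ->.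
- by move=> *; rewrite addrA.
- by move=> *; rewrite addrC.
- by move=> *; rewrite add0r.
- by move=> *; rewrite mulN1r addNr.
- by move=> *; rewrite mulrA.
- by move=> *; rewrite mul1r.
- by move=> *; rewrite mulrDl.
- by move=> *; rewrite mulrDr.
- by move=> *; rewrite mulrC.
- by move=> *; rewrite !mulr0.
Qed.

Lemma sone_neq0 : cls (TConst 1) != 0.
Proof.
apply/eqP => /clsP/taug_eq/= /eqP; by rewrite oner_eq0.
Qed.

HB.instance Definition _ := GRing.Zmodule_isNzRing.Build superalg
  smulA smul1l smul1r smulDl smulDr sone_neq0.

Lemma clsD s t : cls (TAdd s t) = cls s + cls t. Proof. exact: cls_add. Qed.
Lemma clsM s t : cls (TMul s t) = cls s * cls t. Proof. exact: cls_mul. Qed.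

Lemma sscaleE r x : sscale r x = cls (TConst r) * x.
Proof. by elim/cls_ind: x => x; rewrite -cls_scale clsM. Qed.

Lemma sscaleA r s x : sscale r (sscale s x) = sscale (r * s) x.
Proof. by rewrite !sscaleE mulrA -clsM; congr (_ * _); apply/clsP/TE_constM. Qed.

Lemma sscale1 : left_id 1 sscale.
Proof. by move=> x; rewrite sscaleE mul1r. Qed.

Lemma sscaleDr : right_distributive sscale +%R.
Proof. by move=> r x y; rewrite !sscaleE mulrDr. Qed.

Lemma sscaleDl x : {morph sscale^~ x : r s / r + s}.
Proof.
move=> r s; rewrite !sscaleE -mulrDl -clsD; congr (_ * _).
by apply/clsP/TE_sym/TE_constD.
Qed.

HB.instance Definition _ := GRing.Zmodule_isLmodule.Build R superalg
  sscaleA sscale1 sscaleDr sscaleDl.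

Lemma sscaleAl (r : R) (x y : superalg) : r *: (x * y) = (r *: x) * y.
Proof. by rewrite [LHS]sscaleE [in RHS]/GRing.scale/= sscaleE mulrA. Qed.

HB.instance Definition _ := GRing.Lmodule_isLalgebra.Build R superalg sscaleAl.

Lemma cls_const r : cls (TConst r) = r%:A.
Proof. by rewrite [RHS]sscaleE mulr1. Qed.

Lemma sscaleAr (r : R) (x y : superalg) : r *: (x * y) = x * (r *: y).
Proof.
rewrite -[LHS]/(sscale _ _) -[r *: y]/(sscale _ _) !sscaleE !mulrA.
by congr (_ * _); elim/cls_ind: x => x; rewrite -!clsM; apply/clsP/TE_constC.
Qed.

HB.instance Definition _ := GRing.Lalgebra_isAlgebra.Build R superalg sscaleAr.

(* Phi i n is Phi_i(n), meant for n >= 1. *)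
Definition Phi (i : I) (n : nat) : superalg := cls (TGen i n.-1).

Lemma PhiC i m j n : (0 < m)%N -> (0 < n)%N ->
  Phi i m * Phi j n = (-1) ^+ (m * n) *: (Phi j n * Phi i m).
Proof.
case: m n => // m [] // n _ _; rewrite /Phi -!clsM -[RHS]cls_scale.
by apply/clsP/TE_gen.
Qed.

Lemma superalg_ind (P : superalg -> Prop) :
  (forall r : R, P r%:A) -> (forall i n, P (Phi i n.+1)) ->
  (forall x y, P x -> P y -> P (x + y)) ->
  (forall x y, P x -> P y -> P (x * y)) -> forall x, P x.
Proof.
move=> PC PG PD PM; elim/cls_ind; elim.
- by move=> r; rewrite cls_const.
- by move=> i n; exact: PG.
- by move=> x Px y Py; rewrite clsD; exact: PD.
- by move=> x Px y Py; rewrite clsM; exact: PM.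
Qed.

Section Lift.
Variables (B : algType R) (f : I -> nat -> B).

Fixpoint tlift (t : term) : B := match t with
  | TConst r => r%:A
  | TGen i n => f i n.+1
  | TAdd x y => tlift x + tlift y
  | TMul x y => tlift x * tlift y
  end.

Definition slift (x : superalg) : B := tlift (repr x).

Hypothesis fC : forall i m j n, (0 < m)%N -> (0 < n)%N ->
  f i m * f j n = (-1) ^+ (m * n) *: (f j n * f i m).

Lemma tlift_eq s t : term_eq s t -> tlift s = tlift t.
Proof.
elim=> //=.
- by move=> x y z _ -> _ ->.
- by move=> x x' y y' _ -> _ ->.
- by move=> x x' y y' _ -> _ ->.
- by move=> *; rewrite addrA.
- by move=> *; rewrite addrC.
- by move=> *; rewrite scale0r add0r.
- by move=> *; rewrite scaleN1r mulN1r addNr scale0r.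
- by move=> *; rewrite mulrA.
- by move=> *; rewrite scale1r mul1r.
- by move=> *; rewrite mulrDl.
- by move=> *; rewrite mulrDr.
- by move=> *; rewrite scalerDl.
- by move=> *; rewrite -scalerAl mul1r scalerA.
- by move=> *; rewrite -scalerAl -scalerAr mul1r mulr1.
- by move=> i m j n; rewrite fC// -[in RHS]scalerAl mul1r.
Qed.

Lemma slift_cls t : slift (cls t) = tlift t.
Proof. by apply: tlift_eq; exact: repr_cls. Qed.

Lemma slift_const r : slift r%:A = r%:A.
Proof. by rewrite -cls_const slift_cls. Qed.

Lemma slift_Phi i n : (0 < n)%N -> slift (Phi i n) = f i n.
Proof. by case: n => // n _; rewrite slift_cls. Qed.

Lemma sliftD x y : slift (x + y) = slift x + slift y.
Proof.
by elim/cls_ind: x => x; elim/cls_ind: y => y; rewrite -clsD !slift_cls.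
Qed.

Lemma sliftM x y : slift (x * y) = slift x * slift y.
Proof.
by elim/cls_ind: x => x; elim/cls_ind: y => y; rewrite -clsM !slift_cls.
Qed.

End Lift.
End Presentation.
Section Calculus.
Variables (R : realType) (I : choiceType).
Local Notation A := (superalg R I).
Implicit Types (w x y : A) (s t l : bool) (i j : I) (n m : nat).

(* homog s x means x \in A_s; parities are booleans, true being odd. *)
Inductive homog : bool -> A -> Prop :=
  | homog_const (r : R) : homog false r%:A
  | homog_Phi i n : (0 < n)%N -> homog (odd n) (Phi R i n)
  | homog0 s : homog s 0
  | homogD s x y : homog s x -> homog s y -> homog s (x + y)
  | homogM s t x y : homog s x -> homog t y -> homog (s (+) t) (x * y).

(* The parity automorphism, multiplication by (-1)^s on A_s. *)
Definition sgA : A -> A := slift (fun i n => (-1) ^+ n *: Phi R i n).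

Lemma sgA_compat i m j n : (0 < m)%N -> (0 < n)%N ->
  (-1) ^+ m *: Phi R i m * ((-1) ^+ n *: Phi R j n) =
  (-1) ^+ (m * n) *: ((-1) ^+ n *: Phi R j n * ((-1) ^+ m *: Phi R i m)).
Proof.
move=> m0 n0; rewrite -!scalerAl -!scalerAr (PhiC R i j m0 n0) !scalerA.
by congr (_ *: _); rewrite mulrC [X in _ * X]mulrC mulrA.
Qed.

Lemma sgA_const r : sgA r%:A = r%:A.
Proof. exact: (slift_const sgA_compat). Qed.
Lemma sgA_Phi i n : (0 < n)%N -> sgA (Phi R i n) = (-1) ^+ n *: Phi R i n.
Proof. exact: (slift_Phi sgA_compat). Qed.
Lemma sgAD x y : sgA (x + y) = sgA x + sgA y.
Proof. exact: (sliftD sgA_compat). Qed.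
Lemma sgAM x y : sgA (x * y) = sgA x * sgA y.
Proof. exact: (sliftM sgA_compat). Qed.
Lemma sgAZ (r : R) x : sgA (r *: x) = r *: sgA x.
Proof. by rewrite -mulr_algl sgAM sgA_const mulr_algl. Qed.

Lemma sgAK : involutive sgA.
Proof.
elim/superalg_ind => [r|i n|x y Hx Hy|x y Hx Hy].
- by rewrite !sgA_const.
- by rewrite sgA_Phi// sgAZ sgA_Phi// scalerA -expr2 sqrr_sign scale1r.
- by rewrite !sgAD Hx Hy.
- by rewrite !sgAM Hx Hy.
Qed.

(* The component of x in A_s. *)
Definition part (s : bool) x : A := 2^-1 *: (x + (-1) ^+ s *: sgA x).

Lemma partD s x y : part s (x + y) = part s x + part s y.
Proof. by rewrite /part -scalerDr sgAD [(-1) ^+ s *: (_ + _)]scalerDr addrACA. Qed.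

Lemma partZ s (r : R) x : part s (r *: x) = r *: part s x.
Proof.
rewrite /part sgAZ [_ *: (r *: sgA x)]scalerA mulrC -scalerA -scalerDr.
by rewrite scalerA mulrC -scalerA.
Qed.

Lemma sum_part x : part false x + part true x = x.
Proof.
rewrite /part expr0 expr1 scale1r scaleN1r -scalerDr addrACA subrr addr0.
by rewrite -mulr2n -scaler_nat scalerA mulVf ?scale1r// pnatr_eq0.
Qed.

Lemma sgA_homog s x : homog s x -> sgA x = (-1) ^+ s *: x.
Proof.
elim=> {s x}.
- by move=> r; rewrite sgA_const scale1r.
- by move=> i n n0; rewrite sgA_Phi// signr_odd.
- by move=> s; rewrite scaler0 -(scale0r 1) sgA_const.
- by move=> s x y _ Hx _ Hy; rewrite sgAD Hx Hy scalerDr.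
- move=> s t x y _ Hx _ Hy.
  by rewrite sgAM Hx Hy -scalerAl -scalerAr scalerA signr_addb.
Qed.

Lemma homogZ s (r : R) x : homog s x -> homog s (r *: x).
Proof.
by move=> hx; rewrite -mulr_algl; exact: homogM (homog_const r) hx.
Qed.

Lemma homogN s x : homog s x -> homog s (- x).
Proof. by rewrite -scaleN1r; exact: homogZ. Qed.

Lemma homog_sum (T : Type) (r : seq T) (F : T -> A) s :
  (forall k, homog s (F k)) -> homog s (\sum_(k <- r) F k).
Proof.
move=> hF; elim/big_ind : _ => //; [exact: homog0 | move=> x y].
exact: homogD.
Qed.

Lemma sgA_part s x : sgA (part s x) = (-1) ^+ s *: part s x.
Proof.
rewrite /part sgAZ sgAD sgAZ sgAK scalerA mulrC -scalerA; congr (_ *: _).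
by rewrite scalerDr scalerA -expr2 sqrr_sign scale1r addrC.
Qed.

Lemma part_sgA s t x :
  sgA x = (-1) ^+ s *: x -> part t x = if s == t then x else 0.
Proof.
rewrite /part => ->; rewrite scalerA -signr_addb addbC.
case: eqVneq => [->|/negPf st].
  rewrite addbb expr0 scale1r -mulr2n -scaler_nat scalerA.
  by rewrite mulVf ?scale1r// pnatr_eq0.
suff -> : s (+) t by rewrite expr1 scaleN1r subrr scaler0.
by case: s t st => [] [].
Qed.

Lemma part_of_homog s t x : homog s x -> part t x = if s == t then x else 0.
Proof. by move=> /sgA_homog; exact: part_sgA. Qed.

Lemma partM s x y :
  part s (x * y) = part false x * part s y + part true x * part (~~ s) y.
Proof.
have pM a b : part s (part a x * part b y)
    = if a (+) b == s then part a x * part b y else 0.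
  apply: part_sgA.
  by rewrite sgAM !sgA_part -scalerAl -scalerAr scalerA signr_addb.
rewrite -{1}(sum_part x) -{1}(sum_part y) mulrDl !mulrDr !partD !pM.
by case: s {pM} => /=; rewrite !(addr0, add0r).
Qed.

Lemma homog_part s x : homog s (part s x).
Proof.
elim/superalg_ind: x s => [r|i n|x y Hx Hy|x y Hx Hy] s.
- rewrite (part_of_homog _ (homog_const r)).
  by case: eqP => [<-|_]; [exact: homog_const | exact: homog0].
- rewrite (part_of_homog _ (homog_Phi i (ltn0Sn n))).
  by case: eqP => [<-|_]; [exact: homog_Phi | exact: homog0].
- by rewrite partD; apply: homogD.
- rewrite partM; apply: homogD.
    by have := homogM (Hx false) (Hy s).
  by have := homogM (Hx true) (Hy (~~ s)); rewrite /= negbK.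
Qed.

Lemma homogP s x : homog s x <-> sgA x = (-1) ^+ s *: x.
Proof.
split; first exact: sgA_homog.
move=> hx; suff -> : x = part s x by exact: homog_part.
rewrite /part hx scalerA -expr2 sqrr_sign scale1r -mulr2n -scaler_nat.
by rewrite scalerA mulVf ?scale1r// pnatr_eq0.
Qed.

Lemma supercomm s t x y : homog s x -> homog t y ->
  x * y = (-1) ^+ (s && t) *: (y * x).
Proof.
move=> hx; elim: hx t y => {s x}.
- by move=> r t y _; rewrite scale1r mulr_algl mulr_algr.
- move=> i n n0 t y; elim=> {t y}.
  + by move=> r; rewrite andbF scale1r mulr_algl mulr_algr.
  + by move=> j m m0; rewrite (PhiC R i j n0 m0) -signr_odd oddM.
  + by move=> t; rewrite mulr0 mul0r scaler0.
  + by move=> t x y _ Hx _ Hy; rewrite mulrDr mulrDl Hx Hy scalerDr.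
  + move=> s t x y _ Hx _ Hy; rewrite mulrA Hx -scalerAl -[x * _ * y]mulrA Hy.
    rewrite -scalerAr scalerA mulrA -signr_addb; congr (_ *: _).
    by rewrite -andb_addr.
- by move=> s t y _; rewrite mulr0 mul0r scaler0.
- by move=> s x1 x2 _ H1 _ H2 t y hy; rewrite mulrDr mulrDl (H1 t)// (H2 t)// scalerDr.
- move=> s1 s2 x1 x2 _ H1 _ H2 t y hy.
  rewrite -mulrA (H2 t)// -scalerAr [x1 * (_ * _)]mulrA (H1 t)// -scalerAl scalerA.
  rewrite -[y * x1 * x2]mulrA.
  rewrite -signr_addb; congr (_ *: _).
  by rewrite -andb_addl addbC.
Qed.

Lemma homog_comm s z x : homog s z -> z * x = iter s sgA x * z.
Proof.
move=> hz; rewrite -{1}(sum_part x) mulrDr.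
rewrite (supercomm hz (homog_part false x)) (supercomm hz (homog_part true x)).
rewrite andbF andbT scale1r scalerAl -mulrDl; congr (_ * _).
rewrite -{3}(sum_part x); case: s {hz} => /=; last by rewrite scale1r.
by rewrite sgAD !sgA_part scale1r.
Qed.

(* The superderivation of parity l sending Phi_i(n) to f i n; it is well
   defined as soon as f i n has parity l + n, see sderM. On A_s the iterate
   iter l sgA is the sign (-1)^(l s). *)
Section Superderivation.
Variables (l : bool) (f : I -> nat -> A).

Fixpoint tsder (t : term R I) : A := match t with
  | TConst _ => 0
  | TGen i n => f i n.+1
  | TAdd x y => tsder x + tsder y
  | TMul x y => tsder x * cls y + iter l sgA (cls x) * tsder y
  end.

Definition sder (x : A) : A := tsder (repr x).

Hypothesis fh : forall i n, (0 < n)%N -> homog (l (+) odd n) (f i n).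

Let sgl := iter l sgA.
Let sglD x y : sgl (x + y) = sgl x + sgl y.
Proof. by rewrite /sgl; case: l => //=; exact: sgAD. Qed.
Let sglM x y : sgl (x * y) = sgl x * sgl y.
Proof. by rewrite /sgl; case: l => //=; exact: sgAM. Qed.
Let sgl_const r : sgl r%:A = r%:A.
Proof. by rewrite /sgl; case: l => //=; exact: sgA_const. Qed.
Let sgl_homog s x : homog s x -> sgl x = (-1) ^+ (l && s) *: x.
Proof.
rewrite /sgl; case: l => //= hx; last by rewrite scale1r.
exact: sgA_homog.
Qed.

Lemma tsder_eq u v : term_eq u v -> tsder u = tsder v.
Proof.
elim=> //=; rewrite -/sgl.
- by move=> x y z _ -> _ ->.
- by move=> x x' y y' _ -> _ ->.
- by move=> x x' y y' /clsP -> -> /clsP -> ->.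
- by move=> *; rewrite addrA.
- by move=> *; rewrite addrC.
- by move=> *; rewrite add0r.
- by move=> x; rewrite mul0r add0r cls_const sgl_const scaleN1r mulN1r addNr.
- by move=> x y z; rewrite !clsM sglM !mulrDl mulrDr !mulrA addrA.
- by move=> x; rewrite mul0r add0r cls_const sgl_const scale1r mul1r.
- by move=> x y z; rewrite clsD sglD !mulrDl addrACA.
- by move=> x y z; rewrite clsD !mulrDr addrACA.
- by move=> *; rewrite addr0.
- by move=> *; rewrite mul0r mulr0 addr0.
- move=> r x; rewrite mul0r mulr0 add0r addr0 cls_const sgl_const.
  by rewrite mulr_algl mulr_algr.
- move=> i m j n.
  have cP k p : cls (TGen R k p) = Phi R k p.+1 by [].
  rewrite !cP cls_const sgl_const mul0r add0r mulr_algl.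
  rewrite (sgl_homog (homog_Phi i (ltn0Sn m))).
  rewrite (sgl_homog (homog_Phi j (ltn0Sn n))).
  rewrite (supercomm (fh i (ltn0Sn m)) (homog_Phi j (ltn0Sn n))).
  rewrite -!scalerAl (supercomm (homog_Phi i (ltn0Sn m)) (fh j (ltn0Sn n))).
  rewrite scalerDr !scalerA addrC -[(-1) ^+ (m.+1 * n.+1)]signr_odd oddM.
  rewrite -!signr_addb; move: (odd m.+1) (odd n.+1) => p q.
  by congr (_ *: _ + _ *: _); case: (l) p q => [] [] [].
Qed.

Lemma sder_cls (t : term R I) : sder (cls t) = tsder t.
Proof. by apply: tsder_eq; exact: repr_cls. Qed.

Lemma sder_const r : sder r%:A = 0.
Proof. by rewrite -cls_const sder_cls. Qed.

Lemma sder_Phi i n : (0 < n)%N -> sder (Phi R i n) = f i n.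
Proof. by case: n => // n _; rewrite sder_cls. Qed.

Lemma sderD x y : sder (x + y) = sder x + sder y.
Proof.
by elim/cls_ind: x => x; elim/cls_ind: y => y; rewrite -clsD !sder_cls.
Qed.

Lemma sderMl x y : sder (x * y) = sder x * y + iter l sgA x * sder y.
Proof.
by elim/cls_ind: x => x; elim/cls_ind: y => y; rewrite -clsM !sder_cls.
Qed.

Lemma sderM s x y : homog s x ->
  sder (x * y) = sder x * y + (-1) ^+ (l && s) *: (x * sder y).
Proof. by move=> hx; rewrite sderMl -/sgl (sgl_homog hx) scalerAl. Qed.

Lemma sder0 : sder 0 = 0. Proof. by have := sder_const 0; rewrite scale0r. Qed.

Lemma sderZ (r : R) x : sder (r *: x) = r *: sder x.
Proof.
by rewrite -mulr_algl (sderM _ (homog_const r)) sder_const mul0r add0r andbF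
  scale1r mulr_algl.
Qed.

Lemma sderB x y : sder (x - y) = sder x - sder y.
Proof. by rewrite sderD -scaleN1r sderZ scaleN1r. Qed.

Lemma homog_sder s x : homog s x -> homog (l (+) s) (sder x).
Proof.
elim=> {s x}.
- by move=> r; rewrite sder_const; exact: homog0.
- by move=> i n n0; rewrite sder_Phi//; exact: fh.
- by move=> s; rewrite sder0; exact: homog0.
- by move=> s x y _ Hx _ Hy; rewrite sderD; exact: homogD.
- move=> s t x y hx Hx hy Hy; rewrite (sderM _ hx) addbA; apply: homogD.
    exact: homogM.
  by apply: homogZ; rewrite [l (+) s]addbC -addbA; exact: homogM.
Qed.

Lemma sder_sgA x : sder (sgA x) = (-1) ^+ l *: sgA (sder x).
Proof.
elim/superalg_ind: x => [r|i n|x y Hx Hy|x y Hx Hy].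
- by rewrite sgA_const !sder_const -(scale0r 1) sgAZ !scale0r scaler0.
- rewrite sgA_Phi// sderZ !sder_Phi// (sgA_homog (fh i (ltn0Sn n))) scalerA.
  by rewrite -signr_addb addKb signr_odd.
- by rewrite sgAD !sderD Hx Hy sgAD scalerDr.
- rewrite sgAM !sderMl Hx Hy sgAD !sgAM scalerDr scalerAl; congr (_ + _).
  by rewrite -scalerAr; case: l.
Qed.

End Superderivation.

Lemma sder_unique l f (d : A -> A) :
  (forall i n, (0 < n)%N -> homog (l (+) odd n) (f i n)) ->
  (forall r : R, d r%:A = 0) ->
  (forall i n, (0 < n)%N -> d (Phi R i n) = f i n) ->
  (forall x y, d (x + y) = d x + d y) ->
  (forall x y, d (x * y) = d x * y + iter l sgA x * d y) ->
  d =1 sder l f.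
Proof.
move=> fh dC dP dD dM; elim/superalg_ind => [r|i n|x y Hx Hy|x y Hx Hy].
- by rewrite dC sder_const.
- by rewrite dP// sder_Phi.
- by rewrite dD sderD// Hx Hy.
- by rewrite dM sderMl// Hx Hy.
Qed.

(* dPhi j k is the derivation with respect to Phi_j(k), for k >= 1. *)
Definition dPhi j (k : nat) : A -> A :=
  sder (odd k) (fun i n => ((i == j) && (n == k))%:R).

Lemma dPhi_compat j k i n : (0 < n)%N ->
  homog (odd k (+) odd n) (((i == j) && (n == k))%:R : A).
Proof.
move=> _; case: andP => [[_ /eqP ->]|_]; last exact: homog0.
by rewrite addbb -[_%:R](scale1r); exact: homog_const.
Qed.

Definition D : A -> A := sder true (fun i n => Phi R i n.+1).

Lemma D_compat i n : (0 < n)%N -> homog (true (+) odd n) (Phi R i n.+1).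
Proof. by move=> _; exact: (homog_Phi i (ltn0Sn n)). Qed.

Lemma D_Phi i n : (0 < n)%N -> D (Phi R i n) = Phi R i n.+1.
Proof. exact: (sder_Phi D_compat). Qed.

Lemma D_const (r : R) : D r%:A = 0.
Proof. exact: (sder_const D_compat). Qed.

Lemma D0 : D 0 = 0.
Proof. exact: (sder0 D_compat). Qed.

Lemma DD x y : D (x + y) = D x + D y.
Proof. exact: (sderD D_compat). Qed.

Lemma DB x y : D (x - y) = D x - D y.
Proof. exact: (sderB D_compat). Qed.

Lemma DZ (r : R) x : D (r *: x) = r *: D x.
Proof. exact: (sderZ D_compat). Qed.

Lemma DMl x y : D (x * y) = D x * y + sgA x * D y.
Proof. exact: (sderMl D_compat). Qed.

Lemma D_sgA x : D (sgA x) = - sgA (D x).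
Proof. by rewrite /D (sder_sgA D_compat) scaleN1r. Qed.

Lemma DM s x y : homog s x -> D (x * y) = D x * y + (-1) ^+ s *: (x * D y).
Proof. exact: (sderM D_compat). Qed.

Lemma homog_D s x : homog s x -> homog (~~ s) (D x).
Proof. exact: (homog_sder D_compat). Qed.

Lemma homog_iterD n s x : homog s x -> homog (odd n (+) s) (iter n D x).
Proof.
by elim: n => //= n IH /IH/homog_D; rewrite addNb.
Qed.

End Calculus.
Lemma fsbig_sub (M : nmodType) (T : choiceType) (X : {fset T}) (F : T -> M) :
  (forall t, F t != 0 -> t \in X) ->
  \sum_(t \in [set: T]) F t = \sum_(t <- X) F t.
Proof.
by move=> FX; apply: fsbigTE => t; apply: contraNeq; exact: FX.
Qed.

Section LieSuperalgebra.
Variables (R : realType) (I : choiceType).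
Local Notation A := (superalg R I).
Local Notation L := (I -> A).
Implicit Types (w x y : A) (s t : bool) (u v : L).

(* L_s = (A_{s+1})^I, hence the shift of parity. *)
Definition inL s u : Prop := forall i, homog (~~ s) (u i).

Definition Lpart s u : L := fun i => part (~~ s) (u i).

(* Phi_j(n+1) is indexed by p = (j, n); for a given w only finitely many terms
   are nonzero, see dPhi_supp. dvec_h s u is meant for u in L_s, and dvec
   extends it linearly to L. *)
Definition dvec_h s u w : A :=
  \sum_(p \in [set: I * nat])
    (-1) ^+ (s * p.2) *: (iter p.2 (@D R I) (u p.1) * dPhi p.1 p.2.+1 w).

Definition dvec u w : A := \sum_(s : bool) dvec_h s (Lpart s u) w.

Definition bracket u v : L := fun q => \sum_(s : bool) \sum_(t : bool)
  (dvec (Lpart s u) (Lpart t v q)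
   - (-1) ^+ (s * t) *: dvec (Lpart t v) (Lpart s u q)).

Lemma dPhi_supp w : exists X : {fset I * nat},
  forall p : I * nat, dPhi p.1 p.2.+1 w != 0 -> p \in X.
Proof.
elim/superalg_ind: w => [r|i n|x y [X HX] [Y HY]|x y [X HX] [Y HY]].
- exists fset0 => p; rewrite /dPhi sder_const ?eqxx//; exact: dPhi_compat.
- exists [fset (i, n)]%fset => -[j m] /=; rewrite /dPhi sder_Phi//; last first.
    exact: dPhi_compat.
  rewrite eqSS; case: andP => [[/eqP <- /eqP <-] _|_]; first by rewrite inE.
  by rewrite eqxx.
- exists (X `|` Y)%fset => p; rewrite /dPhi sderD; last exact: dPhi_compat.
  rewrite inE; apply: contraR; rewrite negb_or => /andP[pX pY].
  rewrite (contraNeq (HX p) pX : sder _ _ x = 0).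
  by rewrite (contraNeq (HY p) pY : sder _ _ y = 0) addr0.
- exists (X `|` Y)%fset => p; rewrite /dPhi sderMl; last exact: dPhi_compat.
  rewrite inE; apply: contraR; rewrite negb_or => /andP[pX pY].
  rewrite (contraNeq (HX p) pX : sder _ _ x = 0).
  by rewrite (contraNeq (HY p) pY : sder _ _ y = 0) mul0r mulr0 addr0.
Qed.

Section DvecE.
Variables (s : bool) (u : L).
Hypothesis us : inL s u.

Let f i n : A := (-1) ^+ (s * n.-1) *: iter n.-1 (@D R I) (u i).

Lemma dvec_h_compat i n : (0 < n)%N -> homog (s (+) odd n) (f i n).
Proof.
case: n => // n _; apply: homogZ => /=.
by have := homog_iterD n (us i); rewrite addbC addNb -addbN.
Qed.

(* For homogeneous u, dvec_h s u is the superderivation of parity s sending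
   Phi_i(n+1) to (-1)^(s n) D^n(u_i). *)
Lemma dvec_hE w : dvec_h s u w = sder s f w.
Proof.
have c := dvec_h_compat; rewrite /dvec_h.
apply: (sder_unique (d := fun w => dvec_h s u w)) => //.
- move=> r; apply: fsbig1 => -[j n] _.
  by rewrite /dPhi sder_const ?mulr0 ?scaler0//; exact: dPhi_compat.
- move=> i [//|n] _; rewrite /dvec_h (fsbig_sub (X := [fset (i, n)]%fset)).
    rewrite big_seq_fset1 /= /dPhi sder_Phi//; last exact: dPhi_compat.
    by rewrite !eqxx mulr1.
  move=> [j m] /=; rewrite /dPhi sder_Phi//; last exact: dPhi_compat.
  rewrite eqSS inE; apply: contraNT => ne.
  suff -> : (i == j) && (n == m) = false by rewrite mulr0 scaler0.
  by apply: contraNF ne => /andP[/eqP -> /eqP ->].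
- move=> x y; have [X HX] := dPhi_supp x; have [Y HY] := dPhi_supp y.
  have nz z p :
      (-1) ^+ (s * p.2) *: (iter p.2 (@D R I) (u p.1) * dPhi p.1 p.2.+1 z) != 0 ->
      dPhi p.1 p.2.+1 z != 0.
    by apply: contraNN => /eqP ->; rewrite mulr0 scaler0.
  have dD p : dPhi p.1 p.2.+1 (x + y) = dPhi p.1 p.2.+1 x + dPhi p.1 p.2.+1 y.
    by rewrite /dPhi sderD//; exact: dPhi_compat.
  rewrite /dvec_h !(fsbig_sub (X := (X `|` Y)%fset)).
  + by rewrite -big_split; apply: eq_bigr => p _; rewrite dD mulrDr scalerDr.
  + by move=> p /nz/HY; rewrite inE => ->; rewrite orbT.
  + by move=> p /nz/HX; rewrite inE => ->.
  + move=> p /nz; rewrite dD inE; apply: contraR; rewrite negb_or => /andP[pX pY].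
    by rewrite (contraNeq (HX p) pX) (contraNeq (HY p) pY) addr0.
- move=> x y; have [X HX] := dPhi_supp x; have [Y HY] := dPhi_supp y.
  have nz z p :
      (-1) ^+ (s * p.2) *: (iter p.2 (@D R I) (u p.1) * dPhi p.1 p.2.+1 z) != 0 ->
      dPhi p.1 p.2.+1 z != 0.
    by apply: contraNN => /eqP ->; rewrite mulr0 scaler0.
  have dM p : dPhi p.1 p.2.+1 (x * y) = dPhi p.1 p.2.+1 x * y
      + iter (odd p.2.+1) (@sgA R I) x * dPhi p.1 p.2.+1 y.
    by rewrite /dPhi sderMl//; exact: dPhi_compat.
  rewrite /dvec_h !(fsbig_sub (X := (X `|` Y)%fset)).
  + rewrite mulr_suml mulr_sumr -big_split; apply: eq_bigr => p _ /=.
    rewrite dM mulrDr scalerDr -scalerAl mulrA; congr (_ + _).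
    rewrite -scalerAr; congr (_ *: _); rewrite !mulrA; congr (_ * _).
    have hD := homog_iterD p.2 (us p.1).
    rewrite (homog_comm _ hD); congr (_ * _) => /=.
    by case: (odd p.2) (s) => [] [] /=; rewrite ?sgAK.
  + by move=> p /nz/HY; rewrite inE => ->; rewrite orbT.
  + by move=> p /nz/HX; rewrite inE => ->.
  + move=> p /nz; rewrite dM inE; apply: contraR; rewrite negb_or => /andP[pX pY].
    by rewrite (contraNeq (HX p) pX) (contraNeq (HY p) pY) mul0r mulr0 addr0.
Qed.

Lemma dvec_hD w : dvec_h s u (@D R I w) = (-1) ^+ s *: @D R I (dvec_h s u w).
Proof.
have c := dvec_h_compat; rewrite !dvec_hE.
elim/superalg_ind: w => [r|i n|x y Hx Hy|x y Hx Hy].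
- by rewrite D_const (sder_const c) (sder0 c) D0 scaler0.
- rewrite D_Phi// !sder_Phi// /f /= DZ scalerA -exprD.
  by rewrite mulnS.
- by rewrite DD !(sderD c) DD scalerDr Hx Hy.
- rewrite DMl (sderD c) !(sderMl c) Hx Hy DD !DMl (sder_sgA c) scalerDr.
  rewrite !scalerDr -!scalerAl -!scalerAr addrACA [X in _ = X]addrACA.
  rewrite [in LHS]addrACA.
  case: (s) => /=; first by rewrite D_sgA mulNr expr1 !scaleN1r opprK.
  by rewrite expr0 !scale1r.
Qed.

End DvecE.

Lemma Lpart_in s u : inL s (Lpart s u).
Proof. by move=> i; exact: homog_part. Qed.

Lemma dvecD u w : exists z, dvec u (@D R I w) = @D R I z.
Proof.
exists (\sum_(s : bool) (-1) ^+ s *: dvec_h s (Lpart s u) w).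
rewrite /dvec !big_bool DD !DZ.
by rewrite !dvec_hD//; exact: Lpart_in.
Qed.

Lemma dvecB u x y : dvec u (x - y) = dvec u x - dvec u y.
Proof.
rewrite /dvec -sumrB; apply: eq_bigr => s _.
rewrite !dvec_hE; try exact: Lpart_in.
by rewrite sderB//; apply: dvec_h_compat; exact: Lpart_in.
Qed.

Definition DA : {pred A} := fun x => `[< exists z, x = @D R I z >].

Lemma DA_zmod : zmod_closed DA.
Proof.
split=> [|x y /asboolP[x' ->] /asboolP[y' ->]]; apply/asboolP.
  by exists 0; rewrite D0.
by exists (x' - y'); rewrite DB.
Qed.

HB.instance Definition _ := GRing.isZmodClosed.Build A DA DA_zmod.

Definition Atilde : Type := Quotient.quot DA.
HB.instance Definition _ := GRing.Zmodule.on Atilde.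
HB.instance Definition _ := Choice.on Atilde.

Definition tilde w : Atilde := \pi_(Quotient.quot DA) w.

Lemma tildeP x y : tilde x = tilde y <-> exists z, x - y = @D R I z.
Proof.
split=> [/eqP|[z xy]].
  by rewrite /tilde -Quotient.idealrBE => /asboolP.
by apply/eqP; rewrite /tilde -Quotient.idealrBE; apply/asboolP; exists z.
Qed.

Lemma tilde_ind (P : Atilde -> Prop) : (forall w, P (tilde w)) -> forall z, P z.
Proof. by move=> Pw; elim/quotW. Qed.

Lemma repr_tilde x : tilde (repr (tilde x)) = tilde x.
Proof. by rewrite /tilde reprK. Qed.

Lemma tildeD x y : tilde (x + y) = tilde x + tilde y.
Proof. exact: Quotient.pi_add. Qed.

Definition qscale (r : R) (x : Atilde) : Atilde := tilde (r *: repr x).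

Lemma qscaleE (r : R) w : qscale r (tilde w) = tilde (r *: w).
Proof.
apply/tildeP; have /tildeP[z zE] := repr_tilde w.
by exists (r *: z); rewrite -scalerBr zE DZ.
Qed.

Lemma qscaleA r r' (x : Atilde) : qscale r (qscale r' x) = qscale (r * r') x.
Proof. by elim/tilde_ind: x => w; rewrite !qscaleE scalerA. Qed.

Lemma qscale1 : left_id 1 qscale.
Proof. by elim/tilde_ind => w; rewrite qscaleE scale1r. Qed.

Lemma qscaleDr : right_distributive qscale +%R.
Proof.
move=> r; elim/tilde_ind => x; elim/tilde_ind => y.
by rewrite -tildeD !qscaleE scalerDr tildeD.
Qed.

Lemma qscaleDl (x : Atilde) : {morph qscale^~ x : r r' / r + r'}.
Proof.
by elim/tilde_ind: x => w r r'; rewrite !qscaleE scalerDl tildeD.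
Qed.

HB.instance Definition _ := GRing.Zmodule_isLmodule.Build R Atilde
  qscaleA qscale1 qscaleDr qscaleDl.

Lemma tildeZ (r : R) w : tilde (r *: w) = r *: tilde w.
Proof. by rewrite -[RHS]/(qscale _ _) qscaleE. Qed.

Definition act u (x : Atilde) : Atilde := tilde (dvec u (repr x)).

Lemma act_tilde u w : act u (tilde w) = tilde (dvec u w).
Proof.
apply/tildeP; have /tildeP[z zE] := repr_tilde w.
by have [z' zE'] := dvecD u z; exists z'; rewrite -zE' -zE dvecB.
Qed.

Definition Omega : set L := [set xi | finite_set [set i | xi i != 0]].

Definition pairing (xi u : L) : Atilde :=
  \sum_(i \in [set: I]) tilde (u i * xi i).

End LieSuperalgebra.

Section HamiltonianOperators.
Variables (R : realType) (I : choiceType).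
Local Notation A := (superalg R I).
Local Notation L := (I -> A).
Local Notation At := (Atilde R I).
Implicit Types (w : A) (i s t : bool) (p q : I) (u v xi eta : L).

Lemma famD u v q : (u + v) q = u q + v q. Proof. by []. Qed.
Lemma famZ (r : R) u q : (r *: u) q = r *: u q. Proof. by []. Qed.

Lemma OmegaP xi :
  Omega xi <-> exists X : {fset I}, forall q, xi q != 0 -> q \in X.
Proof.
split=> [fxi|[X HX]].
  by exists (fset_set [set q | xi q != 0]) => q xq; rewrite in_fset_set// inE.
by apply: (sub_finite_set _ (finite_fset X)) => q /= /HX.
Qed.

Lemma OmegaD xi eta : Omega xi -> Omega eta -> Omega (xi + eta).
Proof.
move=> /OmegaP[X HX] /OmegaP[Y HY]; apply/OmegaP; exists (X `|` Y)%fset => q.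
rewrite inE; apply: contraR; rewrite negb_or => /andP[qX qY].
by rewrite famD (contraNeq (HX q) qX) (contraNeq (HY q) qY) addr0.
Qed.

Lemma OmegaZ (r : R) xi : Omega xi -> Omega (r *: xi).
Proof.
move=> /OmegaP[X HX]; apply/OmegaP; exists X => q; rewrite famZ.
by move=> h; apply: HX; apply: contraNN h => /eqP ->; rewrite scaler0.
Qed.

Lemma part0 s : part s 0 = 0 :> A.
Proof. by have := partZ s 0 (0 : A); rewrite !scale0r. Qed.

Lemma Omega_part s xi : Omega xi -> Omega (Lpart s xi).
Proof.
move=> /OmegaP[X HX]; apply/OmegaP; exists X => q h; apply: HX.
by apply: contraNN h => /eqP; rewrite /Lpart => ->; rewrite part0.
Qed.

Lemma sum_Lpart u : Lpart false u + Lpart true u = u.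
Proof. by apply/funext => q; rewrite famD addrC; exact: sum_part. Qed.

Lemma LpartD s u v : Lpart s (u + v) = Lpart s u + Lpart s v.
Proof. by apply/funext => q; exact: partD. Qed.

Lemma Lpart_of_inL s t u : inL s u -> Lpart t u = if s == t then u else 0.
Proof.
move=> us; apply/funext => q; rewrite /Lpart (part_of_homog _ (us q)).
by case: s t {us} => [] [].
Qed.

Lemma tilde0 : tilde 0 = 0 :> At.
Proof. by have := tildeZ 0 (0 : A); rewrite !scale0r. Qed.

Lemma pairingE (X : {fset I}) xi u : (forall q, xi q != 0 -> q \in X) ->
  pairing xi u = \sum_(q <- X) tilde (u q * xi q).
Proof.
move=> HX; apply: fsbig_sub => q h; apply: HX; apply: contraNN h => /eqP ->.
by rewrite mulr0 tilde0.
Qed.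

Lemma pairingDr xi u v : Omega xi ->
  pairing xi (u + v) = pairing xi u + pairing xi v.
Proof.
move=> /OmegaP[X HX]; rewrite !(pairingE _ HX) -big_split /=.
by apply: eq_bigr => q _; rewrite famD mulrDl tildeD.
Qed.

Lemma pairingDl xi eta u : Omega xi -> Omega eta ->
  pairing (xi + eta) u = pairing xi u + pairing eta u.
Proof.
move=> /OmegaP[X HX] /OmegaP[Y HY].
rewrite !(@pairingE (X `|` Y)%fset) -?big_split /=.
- by apply: eq_bigr => q _; rewrite famD mulrDr tildeD.
- by move=> q /HY; rewrite inE => ->; rewrite orbT.
- by move=> q /HX; rewrite inE => ->.
- move=> q; rewrite inE; apply: contraR; rewrite negb_or => /andP[qX qY].
  by rewrite famD (contraNeq (HX q) qX) (contraNeq (HY q) qY) addr0.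
Qed.

(* A matrix differential operator of type iota, given by the coefficients
   a^i_{p,q,l} of its entries, l <= n(i,p,q). *)
Record mdo (iota : bool) := Mdo {
  mdo_ord : bool -> I -> I -> nat;
  mdo_coef : bool -> I -> I -> nat -> A;
  mdo_homog : forall i p q l, (l <= mdo_ord i p q)%N ->
    homog (iota (+) odd l) (mdo_coef i p q l)
}.

Section Operator.
Variables (iota : bool) (H : mdo iota).

Definition mdo_entry i p q (x : A) : A :=
  \sum_(l < (mdo_ord H i p q).+1) mdo_coef H i p q l * iter l (@D R I) x.

(* The value on an arbitrary xi is the sum of the values on its components in
   Omega_0 and Omega_1. *)
Definition mdo_fun (xi : L) : L := fun p =>
  \sum_(i : bool) \sum_(q \in [set: I]) mdo_entry i p q (Lpart i xi q).

End Operator.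

Local Coercion mdo_fun : mdo >-> Funclass.

Lemma iterDD n (x y : A) :
  iter n (@D R I) (x + y) = iter n (@D R I) x + iter n (@D R I) y.
Proof. by elim: n => //= n ->; rewrite DD. Qed.

Lemma iterD0 n : iter n (@D R I) 0 = 0.
Proof. by elim: n => //= n ->; rewrite D0. Qed.

Section Theory.
Variables (iota : bool) (H : mdo iota).

Lemma mdo_entry0 i p q : mdo_entry H i p q 0 = 0.
Proof. by rewrite /mdo_entry big1// => l _; rewrite iterD0 mulr0. Qed.

Lemma mdo_entryD i p q x y :
  mdo_entry H i p q (x + y) = mdo_entry H i p q x + mdo_entry H i p q y.
Proof.
rewrite /mdo_entry -big_split; apply: eq_bigr => l _ /=.
by rewrite iterDD mulrDr.
Qed.

Lemma mdo_funE (X : {fset I}) xi p : (forall q, xi q != 0 -> q \in X) ->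
  H xi p = \sum_(i : bool) \sum_(q <- X) mdo_entry H i p q (Lpart i xi q).
Proof.
move=> HX; apply: eq_bigr => i _; apply: fsbig_sub => q h; apply: HX.
by apply: contraNN h => /eqP; rewrite /Lpart => ->; rewrite part0 mdo_entry0.
Qed.

Lemma mdo_funD xi eta : Omega xi -> Omega eta -> H (xi + eta) = H xi + H eta.
Proof.
move=> /OmegaP[X HX] /OmegaP[Y HY]; apply/funext => p /=.
rewrite famD !(@mdo_funE (X `|` Y)%fset) -?big_split /=.
- apply: eq_bigr => i _; rewrite -big_split; apply: eq_bigr => q _ /=.
  by rewrite LpartD mdo_entryD.
- by move=> q /HY; rewrite inE => ->; rewrite orbT.
- by move=> q /HX; rewrite inE => ->.
- move=> q; rewrite inE; apply: contraR; rewrite negb_or => /andP[qX qY].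
  by rewrite famD (contraNeq (HX q) qX) (contraNeq (HY q) qY) addr0.
Qed.

Lemma mdo_inL s xi : inL s xi -> inL (s (+) iota) (H xi).
Proof.
move=> hs p; apply: homog_sum => i; apply: homog_sum => q.
apply: homog_sum => l; rewrite (Lpart_of_inL _ hs).
case: eqP => [si|_]; last by rewrite iterD0 mulr0; exact: homog0.
have hl : (l <= mdo_ord H i p q)%N by rewrite -ltnS ltn_ord.
have := homogM (mdo_homog hl) (homog_iterD l (hs q)); rewrite si.
suff -> : iota (+) odd l (+) (odd l (+) ~~ i) = ~~ (i (+) iota) by [].
by move: (odd l) => o; case: (iota) i o {hl l si} => [] [] [].
Qed.

Definition imH : set L := [set H xi | xi in @Omega R I].

(* omega(H xi1, H xi2) = xi2(H xi1), computed with a chosen preimage of the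
   second argument; omegaHE shows that the choice is irrelevant. *)
Definition omegaH (x y : L) : At :=
  pairing (xget 0 [set xi | Omega xi /\ H xi = y]) x.

Definition super_skew : Prop :=
  forall s1 s2 xi1 xi2, Omega xi1 -> inL s1 xi1 -> Omega xi2 -> inL s2 xi2 ->
    pairing xi1 (H xi2)
    = - ((-1) ^+ ((s1 (+) iota) * (s2 (+) iota)) *: pairing xi2 (H xi1)).

Lemma mdo_ker zeta s : Omega zeta -> H zeta = 0 -> H (Lpart s zeta) = 0.
Proof.
move=> Oz; rewrite -{1}(sum_Lpart zeta) mdo_funD; try exact: Omega_part.
move=> /(congr1 (Lpart (s (+) iota))); rewrite LpartD.
rewrite !(Lpart_of_inL _ (mdo_inL (Lpart_in _ zeta))).
have -> : Lpart (s (+) iota) (0 : L) = 0 by apply/funext => q; exact: part0.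
by case: (s) (iota) H => [] [] ? /=; rewrite ?(addr0, add0r).
Qed.

Lemma omegaHE xi1 xi2 : super_skew -> Omega xi1 -> Omega xi2 ->
  omegaH (H xi1) (H xi2) = pairing xi2 (H xi1).
Proof.
move=> sk O1 O2; rewrite /omegaH.
have [|Oe He] := @xgetPex _ 0 [set xi | Omega xi /\ H xi = H xi2].
  by exists xi2.
set eta := xget _ _ in Oe He *.
have On : Omega (- xi2) by rewrite -scaleN1r; exact: OmegaZ.
have Hz : H (eta + - xi2) = 0.
  apply: (addIr (H xi2)); rewrite -mdo_funD ?subrK ?add0r//; exact: OmegaD.
have Oz := OmegaD Oe On; set zeta := eta + - xi2 in Hz Oz *.
have pz : pairing zeta (H xi1) = 0.
  have zs s t : pairing (Lpart s zeta) (H (Lpart t xi1)) = 0.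
    rewrite (sk s t); try exact: Omega_part; try exact: Lpart_in.
    rewrite mdo_ker// /pairing fsbig1 ?scaler0 ?oppr0// => q _.
    by rewrite mul0r tilde0.
  rewrite -(sum_Lpart zeta) -(sum_Lpart xi1).
  rewrite mdo_funD; try exact: Omega_part.
  rewrite pairingDl; try exact: Omega_part.
  by rewrite !pairingDr ?zs ?addr0//; exact: Omega_part.
by rewrite -(subrK xi2 eta) -/zeta pairingDl// pz add0r.
Qed.

Definition is_subalgebra (S : set L) : Prop :=
  [/\ S 0, (forall u v, S u -> S v -> S (u + v)),
      (forall (r : R) u, S u -> S (r *: u)) &
      (forall u v, S u -> S v -> S (bracket u v))].

End Theory.

(* The terms are those of d om for om of parity w and x1, x2, x3 of parities
   s1, s2, s3, first for i = 1, 2, 3, then for i < j. *)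
Definition dform2 (w : bool) (om : L -> L -> At)
    (s1 : bool) (x1 : L) (s2 : bool) (x2 : L) (s3 : bool) (x3 : L) : At :=
  (-1) ^+ (1 + 1 + w * s1) *: act x1 (om x2 x3)
  + (-1) ^+ (2 + 1 + (w + s1) * s2) *: act x2 (om x1 x3)
  + (-1) ^+ (3 + 1 + (w + s1 + s2) * s3) *: act x3 (om x1 x2)
  + (-1) ^+ (1 + 2) *: om (bracket x1 x2) x3
  + (-1) ^+ (1 + 3 + s2 * s3) *: om (bracket x1 x3) x2
  + (-1) ^+ (2 + 3 + s1 * s2 + s1 * s3) *: om (bracket x2 x3) x1.

(* In xi(u) = sum_i (u_i xi_i)~ the form stands to the right of its argument, so
   moving a derivation to the front does not cross omega_H: d omega_H is taken
   with w = false for every iota. This differs from the signs with w = iota that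
   one writes for forms standing to the left of their arguments; the two agree
   when omega_H(x1, x2) is multiplied by (-1)^(iota (x1 + x2)). Keeping both
   w = iota and omega_H(H xi1, H xi2) = xi2(H xi1) would, for iota = 1, give a
   condition violated by 2 Phi D^2 + Phi(3) with I a point. *)
Definition closed_form iota (H : mdo iota) : Prop :=
  forall s1 s2 s3 x1 x2 x3,
    imH H x1 -> inL s1 x1 -> imH H x2 -> inL s2 x2 -> imH H x3 -> inL s3 x3 ->
    dform2 false (omegaH H) s1 x1 s2 x2 s3 x3 = 0.

Definition hamiltonian iota (H : mdo iota) : Prop :=
  [/\ super_skew H, is_subalgebra (imH H) & closed_form H].

End HamiltonianOperators.

Section NXBialgebra.
Variables (R : realType).

Definition bilinear_map (V W : lmodType R) (f : V -> V -> W) : Prop :=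
  (forall u, linear (f u)) /\ (forall v, linear (f^~ v)).

Definition novikov (V : lmodType R) (op : V -> V -> V) : Prop :=
  [/\ bilinear_map op,
      (forall x y z, op (op x y) z = op (op x z) y) &
      (forall x y z, op (op x y) z - op x (op y z)
                     = op (op y x) z - op y (op x z))].

Definition NX_bialgebra (V : lmodType R) (times circ : V -> V -> V) : Prop :=
  [/\ bilinear_map times /\ commutative times,
      novikov circ,
      (forall u v w, circ (times u v) w = times u (circ v w)),
      (forall u v w, times (times u v) w + times u (times v w)
         = times (circ v u) w + times u (circ v w) - circ v (times u w)) &
      (forall u v w, times (times u v) w - times u (times v w)
         = circ (times u v) w + circ w (times u v)
           - circ u (times v w) - circ (times v w) u)].

Variable (I : choiceType).

(* The space with basis I is {freeg I / R}, with << al >> the basis vector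
   indexed by al. *)
Definition bilin_op (m : I -> I -> I -> R) (u v : {freeg I / R}) :
    {freeg I / R} :=
  fglift (fun al =>
    fglift (fun be => \sum_(ga \in [set: I]) << m al be ga *g ga >>) v) u.

Definition bilin_form (a : I -> I -> R) (u v : {freeg I / R}) : R :=
  fglift (fun al => fglift (fun be => a al be : R^o) v) u.

Lemma bilin_opE m al be : bilin_op m << al >> << be >>
  = \sum_(ga \in [set: I]) << m al be ga *g ga >>.
Proof. by rewrite /bilin_op !liftU !scale1r. Qed.

Lemma bilin_formE a al be : bilin_form a << al >> << be >> = a al be.
Proof. by rewrite /bilin_form !liftU !scale1r. Qed.

End NXBialgebra.

Section TheOperator.
Variables (R : realType) (I : choiceType).
Variables (a : I -> I -> R) (b c d : I -> I -> I -> R).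
Local Notation A := (superalg R I).

Definition H_coef (al be : I) (l : nat) : A :=
  match l with
  | 0 => \sum_(ga \in [set: I]) d al be ga *: Phi R ga 3
  | 1 => \sum_(ga \in [set: I]) c al be ga *: Phi R ga 2
  | 2 => \sum_(ga \in [set: I]) b al be ga *: Phi R ga 1
  | 5 => (a al be)%:A
  | _ => 0
  end.

Lemma H_coef_homog (i : bool) (al be : I) l : (l <= 5)%N ->
  homog (true (+) odd l) (H_coef al be l).
Proof.
move: l => [|[|[|[|[|[|//]]]]]] _ /=; try exact: homog0;
  try exact: homog_const; apply: homog_sum => ga; apply: homogZ.
- exact: (homog_Phi R ga (ltn0Sn 2)).
- exact: (homog_Phi R ga (ltn0Sn 1)).
- exact: (homog_Phi R ga (ltn0Sn 0)).
Qed.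

Definition Hop : mdo R I true :=
  @Mdo R I true (fun _ _ _ => 5%N) (fun _ => H_coef) H_coef_homog.

Lemma Hop_entry i al be (x : A) :
  finite_set [set ga | b al be ga != 0] ->
  finite_set [set ga | c al be ga != 0] ->
  finite_set [set ga | d al be ga != 0] ->
  mdo_entry Hop i al be x = a al be *: iter 5 (@D R I) x
    + \sum_(ga \in [set: I])
        (b al be ga *: (Phi R ga 1 * iter 2 (@D R I) x)
         + c al be ga *: (Phi R ga 2 * D x) + d al be ga *: (Phi R ga 3 * x)).
Proof.
move=> fb fc fd.
pose X := (fset_set [set ga | b al be ga != 0%R] `|`
  fset_set [set ga | c al be ga != 0%R] `|`
  fset_set [set ga | d al be ga != 0%R])%fset.
have sup (F : I -> R) ga : finite_set [set k | F k != 0] -> F ga != 0 ->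
    ga \in fset_set [set k | F k != 0].
  by move=> fF h; rewrite in_fset_set//; exact: mem_set.
have Xb ga : b al be ga != 0 -> ga \in X.
  by move=> /(sup _ _ fb) h; rewrite !inE h.
have Xc ga : c al be ga != 0 -> ga \in X.
  by move=> /(sup _ _ fc) h; rewrite !inE h orbT.
have Xd ga : d al be ga != 0 -> ga \in X.
  by move=> /(sup _ _ fd) h; rewrite !inE h orbT.
have nz (k : R) (y : A) : k *: y != 0 -> k != 0.
  by apply: contraNN => /eqP ->; rewrite scale0r.
rewrite /mdo_entry /= !big_ord_recl big_ord0 /= !mul0r !addr0 !add0r.
rewrite mulr_algl !(fsbig_sub (X := X)); first last.
- by move=> ga /nz/Xd.
- by move=> ga /nz/Xc.
- by move=> ga /nz/Xb.
- move=> ga; apply: contraR => gX.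
  rewrite (contraNeq (Xb ga) gX) (contraNeq (Xc ga) gX) (contraNeq (Xd ga) gX).
  by rewrite !scale0r !addr0.
have E (k : I -> R) n (y : A) : (\sum_(t <- X) k t *: Phi R t n) * y
    = \sum_(t <- X) k t *: (Phi R t n * y).
  by rewrite mulr_suml; apply: eq_bigr => t _; rewrite scalerAl.
rewrite !E !big_split /=.
set S0 := \sum_(t <- X) d al be t *: _; set S1 := \sum_(t <- X) c al be t *: _.
set S2 := \sum_(t <- X) b al be t *: _.
move: (a al be *: _) => T.
by rewrite [LHS]addrC [S1 + (S2 + _)]addrC [S2 + T]addrC !addrA.
Qed.

End TheOperator.

(* Main.v *)
Require Import Defs.
From HB Require Import structures.
From mathcomp Require Import all_boot all_order all_algebra.
From mathcomp Require Import finmap.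
From mathcomp Require Import boolp classical_sets functions cardinality fsbigop.
From mathcomp Require Import reals zify lra.

Set Implicit Arguments.
Unset Strict Implicit.
Unset Printing Implicit Defensive.

Import GRing.Theory Num.Theory.
Local Open Scope classical_set_scope.
Local Open Scope ring_scope.

(** Super skew-symmetry means that H agrees with minus its super adjoint. Comparing
coefficients, this says that the form and the products . and * are symmetric and
that u.v = u o v + v o u - u * v ([tilde_entry_adjoint], [relations_of_skew]).

For a super skew-symmetric H the value of d omega at (H xi1, H xi2, H xi3) is, up to
sign, the value of xi1 on a family J(xi2, xi3) of the form [H xi2, H xi3] - H zeta,
with zeta explicit in terms of xi2 and xi3: all terms in which a vector field
differentiates one of the xi_i cancel by skew-symmetry ([dform2_jacL]). The pairing
is nondegenerate, which is seen with the variational derivative and the test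
functions Phi_j(N)^2 ([nondegenerate_square]). So the image of H is a subalgebra on
which omega is closed if and only if J = 0, and by biadditivity it is enough to look
at simple tensors xi2 = x (x) f and xi3 = y (x) g in V (x) A = Omega.

On simple tensors the component of J at v is a bidifferential operator in f and g:
up to sign, the coefficient of D^j f D^k g is Phi_w(5-j-k) for j + k at most 4, where
w is a signed sum of iterated products of v, x, y; it is a real number for j + k = 7
and 0 otherwise ([jacobiator_seqE]). Taking f and g to be two generators of high order separates these
coefficients ([diffop_coef0]), so J = 0 amounts to 15 identities in V and 8 identities
for the form. Given the relations from skew-symmetry, these are equivalent to the
axioms of an NX-bialgebra and to the invariance of the form: some of the coefficients
are these axioms ([NX_of_coefs], [form_inv_of_coefs]), and all of them follow from the
axioms by linear algebra ([coefV_of_NX], [coefR_of_NX]). *)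

(** * Identities in abelian groups *)

Inductive zexpr : Type :=
  ZAtom of nat | ZZero | ZPlus of zexpr & zexpr | ZOpp of zexpr.

Fixpoint zeval (M : zmodType) (env : seq M) (e : zexpr) : M :=
  match e with
  | ZAtom i => nth 0 env i
  | ZZero => 0
  | ZPlus e1 e2 => zeval env e1 + zeval env e2
  | ZOpp e1 => - zeval env e1
  end.

Fixpoint zocc (sgn : bool) (e : zexpr) (i : nat) : nat :=
  match e with
  | ZAtom j => if sgn then 0%N else eqn i j
  | ZZero => 0%N
  | ZPlus e1 e2 => (zocc sgn e1 i + zocc sgn e2 i)%N
  | ZOpp e1 => zocc (~~ sgn) e1 i
  end.

Lemma zeval_occ (M : zmodType) (env : seq M) e :
  zeval env e = \sum_(i < size env) env`_i *+ zocc false e i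
              - \sum_(i < size env) env`_i *+ zocc true e i.
Proof.
elim: e => [j||e1 IH1 e2 IH2|e IH] /=.
- rewrite [X in _ - X]big1 ?subr0//.
  case: (ltnP j (size env)) => jl.
    rewrite (bigD1 (Ordinal jl)) //= (_ : eqn j j) ?eqnE// mulr1n big1 ?addr0// => i.
    by rewrite -val_eqE /= -eqnE => /negPf ->.
  rewrite nth_default// big1// => i _.
  by rewrite eqnE ltn_eqF ?mulr0n// (leq_trans (ltn_ord i)).
- by rewrite !big1 ?subr0// => i _; rewrite mulr0n.
- rewrite IH1 IH2 addrACA -opprD -!big_split /=.
  by congr (_ - _); apply: eq_bigr => i _; rewrite mulrnDr.
- by rewrite IH opprB.
Qed.

Definition zbalanced n e : bool :=
  all (fun i => eqn (zocc false e i) (zocc true e i)) (iota 0 n).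

Lemma zeval_eq0 (M : zmodType) (env : seq M) n e : size env = n ->
  zbalanced n e -> zeval env e = 0.
Proof.
move=> <- /allP h; rewrite zeval_occ; apply/eqP; rewrite subr_eq0; apply/eqP.
apply: eq_bigr => i _; congr (_ *+ _); apply/eqP; rewrite -eqnE; apply: h.
by rewrite mem_iota /= add0n ltn_ord.
Qed.

(** Compares two terms up to the instances of the ring and module structures, which
rewriting leaves in different but convertible forms. *)
Ltac same t u :=
  lazymatch t with
  | GRing.mul ?a ?b =>
      lazymatch u with GRing.mul ?c ?d => same a c; same b d end
  | GRing.scale ?a ?b =>
      lazymatch u with GRing.scale ?c ?d => same a c; same b d end
  | ?f ?a => lazymatch u with ?g ?b => same f g; same a b end
  | _ => constr_eq t u
  end.

Ltac zindex x env :=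
  match env with
  | cons ?y _ =>
      let _ := match goal with _ => same x y end in constr:(Some O)
  | cons _ ?env' =>
      lazymatch zindex x env' with
      | Some ?n => constr:(Some (S n))
      | None => constr:(@None nat)
      end
  | nil => constr:(@None nat)
  end.

Ltac zatoms t env :=
  lazymatch t with
  | GRing.zero => env
  | GRing.add ?t1 ?t2 => let env1 := zatoms t1 env in zatoms t2 env1
  | GRing.opp ?t1 => zatoms t1 env
  | _ => lazymatch zindex t env with
         | Some _ => env
         | None => constr:(cons t env)
         end
  end.

Ltac zreify t env :=
  lazymatch t with
  | GRing.zero => constr:(ZZero)
  | GRing.add ?t1 ?t2 =>
      let e1 := zreify t1 env in let e2 := zreify t2 env in
      constr:(ZPlus e1 e2)
  | GRing.opp ?t1 => let e1 := zreify t1 env in constr:(ZOpp e1)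
  | _ => lazymatch zindex t env with Some ?n => constr:(ZAtom n) end
  end.

(** Proves an equation that holds in every abelian group once maximal subterms other
than sums, opposites and 0 are taken as atoms. *)
Ltac zmodule :=
  apply/eqP; rewrite -subr_eq0; apply/eqP;
  lazymatch goal with
  | |- @eq ?T ?t _ =>
      let env := zatoms t (@nil T) in
      let e := zreify t env in
      let n := eval cbv in (@size T env) in
      let pf := constr:(@zeval_eq0 _ env n e erefl) in
      let H := fresh in
      (have H : zbalanced n e by vm_compute; reflexivity);
      (* Unifying the structure instances is slow; the kernel converts them at once. *)
      exact_no_check (pf H)
  end.

(** * Partial derivatives *)

Section PartialDerivatives.
Variables (R : realType) (I : choiceType).
Local Notation A := (superalg R I).
Local Notation D := (@D R I).
Implicit Types (x y z u : A) (i j : I) (k m n N : nat).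

Lemma sgA0 : sgA 0 = 0 :> A.
Proof. by have := sgAZ 0 (0 : A); rewrite !scale0r. Qed.

Lemma sgAN x : sgA (- x) = - sgA x.
Proof. by rewrite -scaleN1r sgAZ scaleN1r. Qed.

Lemma DN x : D (- x) = - D x.
Proof. by rewrite -scaleN1r DZ scaleN1r. Qed.

(** Oriented so that exhaustive rewriting pushes signs and the parity automorphism
onto single factors and leaves a signed sum of monomials. *)
Definition signE := (expr0, expr1, @scale1r, @scaleN1r, @opprK, @opprD, @oppr0,
  @mulNr, @mulrN, @mulrDl, @mulrDr, @scalerDr, sgAN, sgAD, sgAK, DN).

Lemma iterDZ n (r : R) x : iter n D (r *: x) = r *: iter n D x.
Proof. by elim: n => //= n ->; rewrite DZ. Qed.

Lemma dPhiD j k x y : dPhi j k (x + y) = dPhi j k x + dPhi j k y.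
Proof. exact: (sderD (@dPhi_compat R I j k)). Qed.
Lemma dPhi0 j k : dPhi j k 0 = 0 :> A.
Proof. exact: (sder0 (@dPhi_compat R I j k)). Qed.
Lemma dPhiZ j k (r : R) x : dPhi j k (r *: x) = r *: dPhi j k x.
Proof. exact: (sderZ (@dPhi_compat R I j k)). Qed.
Lemma dPhiMl j k x y :
  dPhi j k (x * y) = dPhi j k x * y + iter (odd k) (@sgA R I) x * dPhi j k y.
Proof. exact: (sderMl (@dPhi_compat R I j k)). Qed.
Lemma dPhi_const j k (r : R) : dPhi j k r%:A = 0 :> A.
Proof. exact: (sder_const (@dPhi_compat R I j k)). Qed.
Lemma dPhi_Phi j k i n : (0 < n)%N ->
  dPhi j k (Phi R i n) = ((i == j) && (n == k))%:R.
Proof. exact: (sder_Phi (@dPhi_compat R I j k)). Qed.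
Lemma dPhi_sgA j k x : dPhi j k (sgA x) = (-1) ^+ odd k *: sgA (dPhi j k x).
Proof. exact: (sder_sgA (@dPhi_compat R I j k)). Qed.
Lemma dPhi_sum (T : Type) (r : seq T) (P : pred T) (F : T -> A) j k :
  dPhi j k (\sum_(t <- r | P t) F t) = \sum_(t <- r | P t) dPhi j k (F t).
Proof.
by elim/big_rec2: _ => [|t x y _ <-]; rewrite ?dPhi0// dPhiD.
Qed.

Lemma dPhi_nat j k n : dPhi j k (n%:R : A) = 0.
Proof. by rewrite -[n%:R](scaler_nat n (1 : A)) dPhi_const. Qed.

Lemma dPhi_index0 j x : dPhi j 0 x = 0.
Proof.
elim/superalg_ind: x => [r|i n|x y Hx Hy|x y Hx Hy].
- exact: dPhi_const.
- by rewrite dPhi_Phi// andbF.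
- by rewrite dPhiD Hx Hy addr0.
- by rewrite dPhiMl Hx Hy mul0r mulr0 addr0.
Qed.

(** Both sides are superderivations, and D Phi_j(k) = Phi_j(k+1) accounts for the last
term; for k = 0 that term vanishes by [dPhi_index0]. *)
Lemma dPhi_D j k x :
  dPhi j k.+1 (D x) = (-1) ^+ k.+1 *: D (dPhi j k.+1 x) + dPhi j k x.
Proof.
elim/superalg_ind: x => [r|i n|x y Hx Hy|x y Hx Hy].
- by rewrite D_const !dPhi_const dPhi0 D0 scaler0 addr0.
- rewrite D_Phi// !dPhi_Phi// eqSS -[(_ && (n.+1 == k.+1))%:R](scaler_nat _ 1).
  by rewrite D_const scaler0 add0r.
- by rewrite DD !dPhiD DD Hx Hy scalerDr; zmodule.
- rewrite DMl dPhiD !dPhiMl dPhi_sgA Hx Hy DD !DMl -signr_odd /=.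
  by case: (odd k); rewrite /= ?signE ?D_sgA ?signE; zmodule.
Qed.

Lemma dPhi_comm i j k m x :
  dPhi i k (dPhi j m x) = (-1) ^+ (k * m) *: dPhi j m (dPhi i k x).
Proof.
rewrite -signr_odd oddM.
elim/superalg_ind: x => [r|l n|x y Hx Hy|x y Hx Hy].
- by rewrite !dPhi_const !dPhi0 scaler0.
- by rewrite !dPhi_Phi// !dPhi_nat scaler0.
- by rewrite !dPhiD Hx Hy scalerDr.
- rewrite !dPhiMl !dPhiD !dPhiMl Hx Hy.
  case: (odd k) (odd m) (@dPhi_sgA i k) (@dPhi_sgA j m) => [] [] /= sk sm;
  by rewrite ?sk ?sm /= ?signE; zmodule.
Qed.

End PartialDerivatives.

(** * The variational derivative and nondegeneracy of the pairing *)

Section Nondegeneracy.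
Variables (R : realType) (I : choiceType).
Local Notation A := (superalg R I).
Local Notation D := (@D R I).
Local Notation dPhi := (@dPhi R I).
Implicit Types (x y z u : A) (i j : I) (k m n N : nat).

(** The generators Phi_j(m) with m > n do not occur in x. *)
Definition order_le j n x : Prop := forall m, (n < m)%N -> dPhi j m x = 0.

Lemma order_le_exists j x : exists n, order_le j n x.
Proof.
have [X HX] := dPhi_supp x.
exists (\max_(p <- X) p.2.+1)%N => -[//|m] ltm; apply/eqP; apply/negPn/negP.
move=> /(HX (j, m)) jmX; move: ltm; rewrite ltnNge => /negP[].
by rewrite (big_fsetD1 (j, m)) //= leq_maxl.
Qed.

Lemma order_le_mono j m n x : (m <= n)%N -> order_le j m x -> order_le j n x.
Proof. by move=> mn xm k nk; rewrite xm// (leq_ltn_trans mn). Qed.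

Lemma order_le_Phi i j n : (0 < n)%N -> order_le j n (Phi R i n).
Proof. by move=> n0 m nm; rewrite dPhi_Phi// ltn_eqF// andbF. Qed.

Lemma order_leM j n x y :
  order_le j n x -> order_le j n y -> order_le j n (x * y).
Proof. by move=> hx hy m nm; rewrite dPhiMl hx// hy// mul0r mulr0 addr0. Qed.

Lemma order_leD j n x y :
  order_le j n x -> order_le j n y -> order_le j n (x + y).
Proof. by move=> hx hy m nm; rewrite dPhiD hx// hy// addr0. Qed.

Lemma order_leZ j n (r : R) x : order_le j n x -> order_le j n (r *: x).
Proof. by move=> hx m nm; rewrite dPhiZ hx// scaler0. Qed.

Lemma order_le_dPhi j n k x : order_le j n x -> order_le j n (dPhi j k x).
Proof. by move=> hx m nm; rewrite dPhi_comm hx// dPhi0 scaler0. Qed.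

Lemma order_le_D j n x : order_le j n x -> order_le j n.+1 (D x).
Proof.
move=> hx [//|m]; rewrite ltnS => nm.
by rewrite dPhi_D !hx ?D0 ?scaler0 ?addr0// ltnW.
Qed.

(** D Phi_j(m) = Phi_j(m+1), so D^k shifts the order by k and keeps the leading
coefficient. *)
Lemma dPhi_iterD j n k x : order_le j n x ->
  order_le j (n + k) (iter k D x) /\ dPhi j (n + k) (iter k D x) = dPhi j n x.
Proof.
move=> hx; elim: k => [|k [IH1 IH2]]; first by rewrite addn0.
rewrite addnS /=; split; first exact: order_le_D.
by rewrite dPhi_D IH1// D0 scaler0 add0r.
Qed.

(** The variational derivative with respect to Phi_j, truncated after n terms. The
signs (-1)^(k(k-1)/2) are those for which the full sum annihilates D(A): consecutive
terms of [euler (D z)] then telescope. *)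
Definition euler j n x : A :=
  \sum_(k < n) (-1) ^+ 'C(k, 2) *: iter k D (dPhi j k.+1 x).

Lemma euler_D j n z :
  euler j n (D z) = (-1) ^+ ('C(n, 2) + 1) *: iter n D (dPhi j n z).
Proof.
elim: n => [|n IH]; first by rewrite /euler big_ord0 dPhi_index0 scaler0.
rewrite /euler big_ord_recr /= -/(euler _ _ _) IH dPhi_D binS bin1.
rewrite iterDD iterDZ -iterSr /= scalerDr scalerA -exprD !addn1 addnS.
by rewrite [(-1) ^+ 'C(n, 2).+1]exprS mulN1r scaleNr addrCA addNr addr0.
Qed.

(** For N even and large, the only term of order 2N - 1 in the variational derivative
of u Phi_j(N)^2 comes from differentiating the square, and its leading coefficient
is 2u up to sign. A single factor Phi_j(N) would not do: when u is constant,
u Phi_j(N) = D(u Phi_j(N-1)). *)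
Lemma nondegenerate_square j u :
  (forall N, ~~ odd N -> exists z, u * (Phi R j N * Phi R j N) = D z) -> u = 0.
Proof.
move=> H.
have [K uK] := order_le_exists j u.
have [N sN KN] : exists2 N, odd N = false & (K < N)%N.
  by exists K.+1.*2; [exact: odd_double | lia].
have N0 : (0 < N)%N by lia.
have [z zE] := H N (negbT sN).
have [n0 zn] := order_le_exists j z.
pose n := (n0 + N).+1; set P := Phi R j N in zE.
have P1 : dPhi j N P = 1 by rewrite /P dPhi_Phi// !eqxx.
have oP : order_le j N P by exact: order_le_Phi.
have ou : order_le j N u := order_le_mono (ltnW KN) uK.
have E0 : euler j n (u * (P * P)) = 0.
  rewrite zE euler_D zn; last by rewrite /n; lia.
  by elim: (n) => [|k IH]; rewrite ?iterD0 scaler0.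
have dE k : dPhi j k.+1 (u * (P * P)) =
   dPhi j k.+1 u * (P * P) + (k.+1 == N)%:R *: (2%:R *: (u * P)).
  rewrite dPhiMl; congr (_ + _); case: (eqVneq k.+1 N) => [kN|kN].
    rewrite kN dPhiMl P1 sN /= mul1r mulr1 scale1r -mulr2n -scaler_nat.
    by rewrite -scalerAr.
  rewrite dPhiMl /P dPhi_Phi// [N == _]eq_sym (negPf kN) andbF.
  by rewrite mul0r mulr0 addr0 mulr0 scale0r.
(* Of all terms D^k(d_(k+1)(u P P)) only k = N - 1 reaches the order 2N - 1. *)
move: (congr1 (dPhi j (N + N.-1)) E0); rewrite dPhi0 /euler dPhi_sum.
have Nn : (N.-1 < n)%N by rewrite /n; lia.
rewrite (bigD1 (Ordinal Nn)) //= big1 ?addr0; last first.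
  move=> [k kn]; rewrite -val_eqE /= => kN.
  have kN' : (k.+1 == N) = false.
    by apply/eqP => kN1; rewrite -kN1 eqxx in kN.
  rewrite dPhiZ dE kN' scale0r addr0.
  case: (leqP k.+1 K) => kK; last first.
    by rewrite uK// mul0r iterD0 dPhi0 scaler0.
  have ok : order_le j N (dPhi j k.+1 u * (P * P)).
    by apply: order_leM; [exact: order_le_dPhi | exact: order_leM].
  have [okD _] := dPhi_iterD k ok.
  by rewrite okD ?scaler0//; lia.
rewrite dPhiZ dE (_ : N.-1.+1 = N) ?prednK// eqxx scale1r.
rewrite iterDD dPhiD uK// mul0r iterD0 dPhi0 add0r iterDZ dPhiZ.
have [_ ->] := @dPhi_iterD j N N.-1 (u * P) (order_leM ou oP).
rewrite dPhiMl P1 sN /= mulr1.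
rewrite uK// mul0r add0r => /eqP; rewrite !scaler_eq0 signr_eq0 pnatr_eq0 /=.
by move=> /eqP.
Qed.

Lemma iterD_Phi i n k : (0 < n)%N -> iter k D (Phi R i n) = Phi R i (n + k).
Proof.
move=> n0; elim: k => [|k IH]; first by rewrite addn0.
by rewrite addnS /= IH D_Phi// addn_gt0 n0.
Qed.

(** Phi_j(N) has derivatives Phi_j(N+k) that do not occur in the coefficients, so they
are linearly independent over them. *)
Lemma diffop_coef0 j N n (C : nat -> A) : (0 < N)%N ->
  (forall k, (k < n)%N -> order_le j N.-1 (C k)) ->
  \sum_(k < n) C k * iter k D (Phi R j N) = 0 ->
  forall k, (k < n)%N -> C k = 0.
Proof.
move=> N0 hC /(congr1 (dPhi j (N + _))) S0 k kn; move: (S0 k).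
rewrite dPhi0 dPhi_sum (bigD1 (Ordinal kn)) //= big1 ?addr0; last first.
  move=> [l ln]; rewrite -val_eqE /= => lk.
  rewrite dPhiMl (hC l ln) ?mul0r ?add0r; last by lia.
  rewrite iterD_Phi// dPhi_Phi ?addn_gt0 ?N0// eqxx eqn_add2l (negPf lk).
  by rewrite mulr0.
rewrite dPhiMl (hC k kn) ?mul0r ?add0r; last by lia.
rewrite iterD_Phi// dPhi_Phi ?addn_gt0 ?N0// !eqxx mulr1.
by case: (odd _) => //= /(congr1 (@sgA R I)); rewrite sgAK sgA0.
Qed.

End Nondegeneracy.

(** * The Jacobiator as a bidifferential operator *)

(** The expansion depends only on the sign rule, so it is carried out in an arbitrary
algebra with a parity automorphism sg and an odd superderivation D; F n v stands
for the extension of Phi_i(n) to a linear function of v in V. *)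
Section JacobiatorExpansion.
Variables (R : realType) (A : algType R) (V : zmodType).
Variables (sg D : A -> A).
Hypothesis derD : {morph D : x y / x + y}.
Hypothesis derZ : forall r : R, {morph D : x / r *: x}.
Hypothesis derM : forall x y, D (x * y) = D x * y + sg x * D y.
Variables (F : nat -> V -> A).
Hypothesis FD : forall n, {morph F n : v w / v + w}.
Hypothesis FN : forall n, {morph F n : v / - v}.
Hypothesis derF : forall n v, (0 < n)%N -> D (F n v) = F n.+1 v.
Hypothesis sgF : forall n v, (0 < n)%N -> sg (F n v) = (-1) ^+ odd n *: F n v.
Variables (a : V -> V -> R) (b c d : V -> V -> V).

(** The component at v of the image of x (x) f under the operator with coefficients
a, b, c, d. *)
Definition op_entry (v x : V) (f : A) : A :=
  a v x *: iter 5 D f + F 1 (b v x) * iter 2 D f + F 2 (c v x) * D f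
  + F 3 (d v x) * f.

(** The component at v of [H xi, H eta] - H zeta for xi = x (x) f and eta = y (x) g of
parities p and q, where zeta is built by transposition as in
[transpose_tens]; the terms in which the vector fields differentiate f or g have
already cancelled. *)
Definition jacobiator (p q : bool) (v x y : V) (f g : A) : A :=
  op_entry (b v y) x f * iter 2 D g
  + (-1) ^+ p *: (D (op_entry (c v y) x f) * D g)
  + iter 2 D (op_entry (d v y) x f) * g
  - (-1) ^+ (p && q) *:
      (op_entry (b v x) y g * iter 2 D f
       + (-1) ^+ q *: (D (op_entry (c v x) y g) * D f)
       + iter 2 D (op_entry (d v x) y g) * f)
  + (-1) ^+ (p && q) *:
      (op_entry v (b x y) (iter 2 D g * f) + op_entry v (c x y) (D (D g * f))
       - op_entry v (d x y) (iter 2 D (g * f))).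

(** Up to the sign (-1)^(pk), the coefficient of D^j f D^k g in the Jacobiator is
Phi_w(5-j-k) with w given here. *)
Definition jac_coefV (j k : nat) (v x y : V) : V :=
  match j, k with
  | 0%N, 4%N => b v (b x y) + b v (c x y) - b (d v x) y - b v (d x y)
  | 1%N, 3%N => b v (c x y) - b (c v x) y
  | 2%N, 2%N => b (b v y) x + b v (b x y) + b v (c x y) - b (b v x) y
            - b v (d x y) - b v (d x y)
  | 3%N, 1%N => b v (c x y) - b (c v y) x
  | 4%N, 0%N => b (d v y) x - b v (d x y)
  | 0%N, 3%N => c v (b x y) + c v (c x y) - c (d v x) y - c v (d x y)
  | 1%N, 2%N => c (b v y) x + c v (b x y) - b (c v x) y - c (c v x) y - c v (d x y)
  | 2%N, 1%N => b (c v y) x + c (c v y) x + c v (c x y) - c (b v x) y - c v (d x y)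
  | 3%N, 0%N => c (d v y) x - c v (d x y)
  | 0%N, 2%N => d (b v y) x + d v (b x y) + d v (c x y) - b (d v x) y - d (d v x) y
            - d v (d x y)
  | 1%N, 1%N => c (c v y) x + c (c v x) y + d v (c x y) - d (c v y) x - d (c v x) y
  | 2%N, 0%N => b (d v y) x + d (d v y) x - d (b v x) y - d v (d x y)
  | 0%N, 1%N => d (c v y) x - c (d v x) y
  | 1%N, 0%N => c (d v y) x - d (c v x) y
  | 0%N, 0%N => d (d v y) x - d (d v x) y
  | _, _ => 0
  end.

(** The constant coefficients, which come from the term a D^5 and hence have
j + k = 7. *)
Definition jac_coefR (j k : nat) (v x y : V) : R :=
  match j, k with
  | 0%N, 7%N => a v (b x y) + a v (c x y) - a (d v x) y - a v (d x y)
  | 1%N, 6%N => a v (b x y) - a (c v x) y - a v (d x y)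
  | 2%N, 5%N => a v (c x y) *+ 3 + a v (b x y) *+ 2 - a (b v x) y - a v (d x y) *+ 3
  | 3%N, 4%N => a v (b x y) *+ 2 - a v (d x y) *+ 3
  | 4%N, 3%N => a v (c x y) *+ 3 + a v (b x y) - a v (d x y) *+ 3
  | 5%N, 2%N => a (b v y) x + a v (b x y) - a v (d x y) *+ 3
  | 6%N, 1%N => a (c v y) x + a v (c x y) - a v (d x y)
  | 7%N, 0%N => a (d v y) x - a v (d x y)
  | _, _ => 0
  end.

Definition jac_coef (p : bool) (j k : nat) (v x y : V) : A :=
  (-1) ^+ (p && odd k) *:
    (if (j + k <= 4)%N then F (5 - j - k) (jac_coefV j k v x y)
     else (jac_coefR j k v x y)%:A).


Let sg_sign (s : bool) x : sg x = (-1) ^+ s *: x -> sg x = if s then - x else x.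
Proof. by case: s => ->; rewrite ?scaleN1r ?scale1r. Qed.

Hypothesis sg_D : forall x, sg (D x) = - D (sg x).
Hypothesis sgK : involutive sg.

(** The two cross terms cancel because D anticommutes with sg. *)
Lemma derDM x y : D (D (x * y)) = D (D x) * y + x * D (D y).
Proof. by rewrite derM derD !derM sg_D sgK mulNr addrA subrK. Qed.

Section Sequences.
Variable f : nat -> A.
Hypothesis Df : forall k, D (f k) = f k.+1.

Lemma op_entry_seq v x : op_entry v x (f 0%N) =
  a v x *: f 5 + F 1 (b v x) * f 2 + F 2 (c v x) * f 1 + F 3 (d v x) * f 0%N.
Proof. by rewrite /op_entry /= !Df. Qed.

Lemma D_op_entry_seq v x : D (op_entry v x (f 0%N)) =
  a v x *: f 6 + (F 2 (b v x) * f 2 - F 1 (b v x) * f 3)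
  + (F 3 (c v x) * f 1 + F 2 (c v x) * f 2)
  + (F 4 (d v x) * f 0%N - F 3 (d v x) * f 1).
Proof.
rewrite op_entry_seq !derD derZ !derM !derF// !Df !(sg_sign (sgF _ _)) //=.
by rewrite !mulNr.
Qed.

Lemma D2_op_entry_seq v x : D (D (op_entry v x (f 0%N))) =
  a v x *: f 7 + (F 3 (b v x) * f 2 + F 1 (b v x) * f 4)
  + (F 4 (c v x) * f 1 + F 2 (c v x) * f 3)
  + (F 5 (d v x) * f 0%N + F 3 (d v x) * f 2).
Proof. by rewrite op_entry_seq !derD !derZ !derDM !derF// !Df. Qed.

End Sequences.

Lemma op_entryD v x (f g : A) :
  op_entry v x (f + g) = op_entry v x f + op_entry v x g.
Proof. by rewrite /op_entry /= !derD scalerDr !mulrDr; zmodule. Qed.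

Lemma op_entryZ v x (r : R) (f : A) : op_entry v x (r *: f) = r *: op_entry v x f.
Proof.
by rewrite /op_entry /= !derZ !scalerDr -!scalerAr !scalerA [r * _]mulrC.
Qed.

Section Product.
Variables (p q : bool) (f g : nat -> A).
Hypothesis Df : forall k, D (f k) = f k.+1.
Hypothesis Dg : forall k, D (g k) = g k.+1.
Hypothesis sf : forall k, sg (f k) = (-1) ^+ (p (+) odd k) *: f k.
Hypothesis gf : forall j k, g k * f j =
    (-1) ^+ ((p (+) odd j) && (q (+) odd k)) *: (f j * g k).

Let Dfg j k :
  D (f j * g k) = f j.+1 * g k + (-1) ^+ (p (+) odd j) *: (f j * g k.+1).
Proof. by rewrite derM Df Dg sf -scalerAl. Qed.

Let D2fg j k : D (D (f j * g k)) = f j.+2 * g k + f j * g k.+2.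
Proof. by rewrite derDM !Df !Dg. Qed.

Lemma op_entry_prod v x j k : op_entry v x (f j * g k) =
  a v x *: (f j.+1 * g k.+4 + f j.+3 * g k.+2 *+ 2 + f j.+1.+4 * g k
   + (-1) ^+ (p (+) odd j) *:
       (f j * g k.+1.+4 + f j.+2 * g k.+3 *+ 2 + f j.+4 * g k.+1))
  + F 1 (b v x) * (f j.+2 * g k + f j * g k.+2)
  + F 2 (c v x) * (f j.+1 * g k + (-1) ^+ (p (+) odd j) *: (f j * g k.+1))
  + F 3 (d v x) * (f j * g k).
Proof.
rewrite /op_entry /= !D2fg !Dfg; congr (_ *: _ + _ + _ + _).
rewrite !derD !D2fg !derD !Dfg !mulr2n /= !negbK !scalerDr; zmodule.
Qed.

(** In this lemma and the next two the signs produced by moving g behind f absorb the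
sign of the second half of the Jacobiator, so that q disappears. *)
Lemma op_entry_swap w y :
  (-1) ^+ (p && q) *: (op_entry w y (g 0%N) * f 2) =
  (-1) ^+ p *: (a w y *: (f 2 * g 5)) + F 1 (b w y) * (f 2 * g 2)
  + (-1) ^+ p *: (F 2 (c w y) * (f 2 * g 1%N)) + F 3 (d w y) * (f 2 * g 0%N).
Proof.
rewrite (op_entry_seq Dg) !mulrDl -!scalerAl -!mulrA !gf.
by case: (p) (q) => [] []; rewrite /= ?(expr0, expr1, scale1r, scaleN1r,
  mulrN, scalerN, opprD, opprK).
Qed.

Lemma D_op_entry_swap w y :
  (-1) ^+ (p && q) *: ((-1) ^+ q *: (D (op_entry w y (g 0%N)) * f 1%N)) =
  a w y *: (f 1%N * g 6) + F 2 (b w y) * (f 1%N * g 2)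
  + (-1) ^+ p *: (F 1 (b w y) * (f 1%N * g 3))
  - (-1) ^+ p *: (F 3 (c w y) * (f 1%N * g 1%N)) + F 2 (c w y) * (f 1%N * g 2)
  + F 4 (d w y) * (f 1%N * g 0%N) + (-1) ^+ p *: (F 3 (d w y) * (f 1%N * g 1%N)).
Proof.
rewrite (D_op_entry_seq Dg) !(mulrDl, mulNr) -!scalerAl -!mulrA !gf.
case: (p) (q) => [] []; rewrite /= ?(expr0, expr1, scale1r, scaleN1r,
  mulrN, scalerN, opprD, opprK); zmodule.
Qed.

Lemma D2_op_entry_swap w y :
  (-1) ^+ (p && q) *: (D (D (op_entry w y (g 0%N))) * f 0%N) =
  (-1) ^+ p *: (a w y *: (f 0%N * g 7))
  + F 3 (b w y) * (f 0%N * g 2) + F 1 (b w y) * (f 0%N * g 4)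
  + (-1) ^+ p *: (F 4 (c w y) * (f 0%N * g 1%N)
                  + F 2 (c w y) * (f 0%N * g 3))
  + F 5 (d w y) * (f 0%N * g 0%N) + F 3 (d w y) * (f 0%N * g 2).
Proof.
rewrite (D2_op_entry_seq Dg) !(mulrDl, mulNr) -!scalerAl -!mulrA !gf.
case: (p) (q) => [] []; rewrite /= ?(expr0, expr1, scale1r, scaleN1r,
  mulrN, scalerN, opprD, opprK); zmodule.
Qed.

End Product.

(** After the factors g have been moved behind the factors f, both sides are sums of
monomials F n w f_j g_k; the parity p enters only through (-1)^(pk), the sign of
moving D^k past f. *)
Lemma jacobiator_seqE p q (f g : nat -> A) v x y :
  (forall k, D (f k) = f k.+1) -> (forall k, D (g k) = g k.+1) ->
  (forall k, sg (f k) = (-1) ^+ (p (+) odd k) *: f k) ->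
  (forall k, sg (g k) = (-1) ^+ (q (+) odd k) *: g k) ->
  (forall j k, g k * f j =
    (-1) ^+ ((p (+) odd j) && (q (+) odd k)) *: (f j * g k)) ->
  jacobiator p q v x y (f 0%N) (g 0%N) =
    \sum_(j < 8) \sum_(k < 8) jac_coef p j k v x y * (f j * g k).
Proof.
move=> Df Dg sf sg' gf.

have pqE (u : A) (r : bool) : r = p && q -> (-1) ^+ (p && q) *: ((-1) ^+ r *: u) = u.
  by move=> ->; rewrite scalerA -expr2 sqrr_sign scale1r.
have bE : (-1) ^+ (p && q) *: op_entry v (b x y) (g 2%N * f 0%N) =
    op_entry v (b x y) (f 0%N * g 2%N).
  by rewrite gf op_entryZ pqE //= !addbF.
have cE : (-1) ^+ (p && q) *: op_entry v (c x y) (D (g 1%N * f 0%N)) =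
    op_entry v (c x y) (f 0%N * g 2%N)
    + (-1) ^+ p *: op_entry v (c x y) (f 1%N * g 1%N).
  rewrite derM Df Dg sg' -scalerAl !gf op_entryD !op_entryZ /=.
  by case: (p) (q) => [] []; rewrite /= ?(expr0, expr1, scale1r, scaleN1r,
    scalerN, opprD, opprK).
have dE : (-1) ^+ (p && q) *: op_entry v (d x y) (D (D (g 0%N * f 0%N))) =
    op_entry v (d x y) (f 0%N * g 2%N) + op_entry v (d x y) (f 2%N * g 0%N).
  by rewrite derDM !Dg !Df !gf op_entryD !op_entryZ scalerDr !pqE //= !addbF.
have dist3 (e : R) (t1 t2 t3 : A) :
    e *: (t1 + t2 + t3) = e *: t1 + e *: t2 + e *: t3 by rewrite !scalerDr.
rewrite /jacobiator /= !Dg !Df (dist3 _ (op_entry _ _ _ * _)).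
rewrite (dist3 _ (op_entry v (b x y) _) (op_entry v (c x y) _)) scalerN bE cE dE.
rewrite (op_entry_swap Dg gf) (D_op_entry_swap Dg gf) (D2_op_entry_swap Dg gf).
rewrite !(op_entry_seq Df, D_op_entry_seq Df, D2_op_entry_seq Df).
rewrite !(op_entry_prod Df Dg sf).
rewrite !big_ord_recl !big_ord0 /jac_coef /= /bump /= !(add1n, addn0, subSS, subn0).
rewrite ?(scale0r, mul0r, scaler0, addr0, add0r).
rewrite !(FD, FN).
case: p {sf gf sg' pqE bE cE dE dist3} => /=;
  rewrite !expr0 ?expr1 ?scaleN1r ?scale1r !(mulrSr, mulr0n, add0r);
  rewrite !(mulNr, mulr_algl, opprK) !opprD !mulrDl ?mulNr !mulrDr ?mulrN;
  rewrite ?(scalerDl, scaleNr) ?scalerDr ?scalerN ?opprD ?opprK !mulrA;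
  rewrite -?scalerAl; zmodule.
Qed.

End JacobiatorExpansion.

(** * Evolutionary vector fields *)

Section Evolutionary.
Variables (R : realType) (I : choiceType).
Local Notation A := (superalg R I).
Local Notation L := (I -> A).
Local Notation At := (Atilde R I).
Local Notation D := (@D R I).
Implicit Types (x y w : A) (s t : bool) (u v xi eta : L).

Lemma homog_eq s t x : s = t -> homog s x -> homog t x.
Proof. by move=> ->. Qed.

Lemma inLD s u v : inL s u -> inL s v -> inL s (u + v).
Proof. by move=> hu hv i; apply: homogD; [exact: hu | exact: hv]. Qed.

Lemma inL0 s : inL s (0 : L).
Proof. by move=> i; exact: homog0. Qed.

Lemma Omega0 : Omega (0 : L).
Proof. by apply/OmegaP; exists fset0 => q; rewrite eqxx. Qed.

Lemma dvec_h0 s w : dvec_h s (0 : L) w = 0.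
Proof.
rewrite /dvec_h fsbig1// => p _.
by rewrite (_ : (0 : L) p.1 = 0)// iterD0 mul0r scaler0.
Qed.

Lemma dvec_inL s u w : inL s u -> dvec u w = dvec_h s u w.
Proof.
move=> us; rewrite /dvec big_bool /= !(Lpart_of_inL _ us).
by case: s us => us; rewrite dvec_h0 ?addr0 ?add0r.
Qed.

Section Derivation.
Variables (s : bool) (u : L).
Hypothesis us : inL s u.

Let uc := dvec_h_compat us.

Lemma dvec_Phi i n : dvec u (Phi R i n.+1) = (-1) ^+ (s * n) *: iter n D (u i).
Proof. by rewrite (dvec_inL _ us) (dvec_hE us) (sder_Phi uc). Qed.

Lemma dvec_const (r : R) : dvec u r%:A = 0.
Proof. by rewrite (dvec_inL _ us) (dvec_hE us) (sder_const uc). Qed.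

Lemma dvec_0 : dvec u 0 = 0.
Proof. by rewrite (dvec_inL _ us) (dvec_hE us) (sder0 uc). Qed.

Lemma dvec_D w : dvec u (D w) = (-1) ^+ s *: D (dvec u w).
Proof. by rewrite !(dvec_inL _ us) (dvec_hD us). Qed.

Lemma dvec_iterD n w : dvec u (iter n D w) = (-1) ^+ (s * n) *: iter n D (dvec u w).
Proof.
elim: n => [|n IH]; first by rewrite muln0 scale1r.
by rewrite /= dvec_D IH DZ scalerA -exprD -mulnS.
Qed.

Lemma dvec_add x y : dvec u (x + y) = dvec u x + dvec u y.
Proof. by rewrite !(dvec_inL _ us) !(dvec_hE us) (sderD uc). Qed.

Lemma dvec_scale (r : R) x : dvec u (r *: x) = r *: dvec u x.
Proof. by rewrite !(dvec_inL _ us) !(dvec_hE us) (sderZ uc). Qed.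

Lemma dvec_mul t x y : homog t x ->
  dvec u (x * y) = dvec u x * y + (-1) ^+ (s && t) *: (x * dvec u y).
Proof. by rewrite !(dvec_inL _ us) !(dvec_hE us) => xt; rewrite (sderM uc _ xt). Qed.

Lemma homog_dvec t x : homog t x -> homog (s (+) t) (dvec u x).
Proof. by rewrite (dvec_inL _ us) (dvec_hE us); exact: homog_sder. Qed.

Lemma act_add (z z' : At) : act u (z + z') = act u z + act u z'.
Proof.
elim/tilde_ind: z => z; elim/tilde_ind: z' => z'.
by rewrite -tildeD !act_tilde dvec_add tildeD.
Qed.

Lemma act0 : act u (0 : At) = 0.
Proof. by rewrite -tilde0 act_tilde dvec_0. Qed.

End Derivation.

(** Both sides are superderivations that agree on the generators. *)
Lemma dvec_addl s u v w : inL s u -> inL s v ->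
  dvec (u + v) w = dvec u w + dvec v w.
Proof.
move=> us vs; have uvs := inLD us vs.
elim/superalg_ind: w => [r|i n|x y Hx Hy|x y Hx Hy].
- by rewrite (dvec_const uvs) (dvec_const us) (dvec_const vs) addr0.
- rewrite (dvec_Phi uvs) (dvec_Phi us) (dvec_Phi vs) -scalerDr -iterDD.
  by rewrite famD.
- by rewrite (dvec_add uvs) (dvec_add us) (dvec_add vs) Hx Hy addrACA.
- rewrite -(sum_part x) in Hx *; rewrite !mulrDl.
  rewrite !(dvec_add uvs) !(dvec_add us) !(dvec_add vs) in Hx *.
  have E k : dvec (u + v) (part k x * y) = dvec (u + v) (part k x) * y +
    (-1) ^+ (s && k) *: (part k x * (dvec u y + dvec v y)).
    by rewrite (dvec_mul uvs _ (homog_part k x)) Hy.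
  rewrite !E (dvec_mul us _ (homog_part false x)) (dvec_mul vs _ (homog_part false x)).
  rewrite (dvec_mul us _ (homog_part true x)) (dvec_mul vs _ (homog_part true x)).
  rewrite addrACA -mulrDl Hx.
  rewrite !mulrDr !scalerDr !mulrDl; zmodule.
Qed.

(** The derivation of A attached to u, applied to each component of a family. *)
Definition dL u v : L := fun q => dvec u (v q).

Lemma dL_inL s t u v : inL s u -> inL t v -> inL (s (+) t) (dL u v).
Proof. by move=> us vt i; rewrite -addbN; exact: (homog_dvec us). Qed.

Lemma dL_Omega s u xi : inL s u -> Omega xi -> Omega (dL u xi).
Proof.
move=> us /OmegaP[X HX]; apply/OmegaP; exists X => q h; apply: HX.
by apply: contraNN h => /eqP xq; rewrite /dL xq (dvec_0 us).
Qed.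

Lemma dL_add s u v v' : inL s u -> dL u (v + v') = dL u v + dL u v'.
Proof. by move=> us; apply/funext => q; exact: (dvec_add us). Qed.

Lemma dL_addl s u u' v : inL s u -> inL s u' -> dL (u + u') v = dL u v + dL u' v.
Proof. by move=> us us'; apply/funext => q; exact: (dvec_addl _ us). Qed.

Lemma bracketE s t u v : inL s u -> inL t v ->
  bracket u v = dL u v - (-1) ^+ (s * t) *: dL v u.
Proof.
move=> us vt; apply/funext => q; rewrite /bracket !big_bool /=.
rewrite !(Lpart_of_inL _ us) !(Lpart_of_inL _ vt).
have z0 : (0 : L) q = 0 by [].
have z1 w : dvec (0 : L) w = 0 by rewrite (dvec_inL _ (inL0 s)) dvec_h0.
have [zu zv] := (dvec_0 us, dvec_0 vt).
case: s t us vt => [] [] us vt; rewrite /= ?z0 ?z1 ?zu ?zv ?z1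
  ?(scaler0, oppr0, addr0, add0r);
  reflexivity.
Qed.

(** Leibniz rule for the components v_i xi_i; the sign comes from moving the derivation
past v_i, whose parity is ~~ t. *)
Lemma act_pairing s t u v xi : inL s u -> inL t v -> Omega xi ->
  act u (pairing xi v) =
  pairing xi (dL u v) + (-1) ^+ (s && ~~ t) *: pairing (dL u xi) v.
Proof.
move=> us vt /OmegaP[X HX].
have HdX q : dL u xi q != 0 -> q \in X.
  move=> h; apply: HX; apply: contraNN h => /eqP xq.
  by rewrite /dL xq (dvec_0 us).
rewrite !(pairingE _ HX) (pairingE _ HdX) scaler_sumr -big_split /=.
elim/big_rec2: _ => [|q z1 z2 _ <-]; first exact: (act0 us).
rewrite (act_add us) act_tilde; congr (_ + _).
by rewrite (dvec_mul us _ (vt q)) tildeD tildeZ.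
Qed.

End Evolutionary.

(** * Closedness of the 2-form *)

Section Closedness.
Variables (R : realType) (I : choiceType).
Local Notation A := (superalg R I).
Local Notation L := (I -> A).
Local Notation At := (Atilde R I).
Implicit Types (s t : bool) (u v xi eta : L).
Variable H : mdo R I true.
Local Notation "'Hf'" := (mdo_fun H).

Lemma pairingZr xi (r : R) u :
  Omega xi -> pairing xi (r *: u) = r *: pairing xi u.
Proof.
move=> /OmegaP[X HX]; rewrite !(pairingE _ HX) scaler_sumr.
by apply: eq_bigr => q _; rewrite famZ -scalerAl tildeZ.
Qed.

Lemma pairingNr xi u : Omega xi -> pairing xi (- u) = - pairing xi u.
Proof. by move=> Oxi; rewrite -scaleN1r pairingZr// scaleN1r. Qed.

(** The derivative of H along u with its argument held fixed: the part of d_u(H xi) in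
which u differentiates the coefficients of H. *)
Definition deriv_op s u xi : L := dL u (Hf xi) - (-1) ^+ s *: Hf (dL u xi).

Lemma inL_image s xi : inL (~~ s) xi -> inL s (Hf xi).
Proof. by move=> /(mdo_inL H); rewrite addbT negbK. Qed.

Lemma pairing_deriv_op s t t' u xi eta : super_skew H ->
  Omega eta -> inL (~~ t) eta -> Omega xi -> inL (~~ t') xi -> inL s u ->
  pairing eta (deriv_op s u xi) = pairing eta (dL u (Hf xi))
    + (-1) ^+ s *: ((-1) ^+ (t * (s (+) t')) *: pairing (dL u xi) (Hf eta)).
Proof.
move=> sk Oe ie Ox ix us; rewrite pairingDr// pairingNr// pairingZr//.
congr (_ + _); rewrite (sk (~~ t) (s (+) ~~ t')) //; first last.
- exact: dL_inL.
- exact: dL_Omega us _.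
by rewrite !addbT !negbK addbN negbK scalerN opprK.
Qed.

(** The sign bookkeeping of [dform2_jacL]: A1, A2, A5, A7, A8, A9 stand for
values of xi_k on d_(x_i)(x_j), and A3, A4, A6 for values of d_(x_i)(xi_j) on x_k. *)
Lemma dform2_signs (M : lmodType R) (A1 A2 A3 A4 A5 A6 A7 A8 A9 : M) s1 s2 s3 :
  (-1) ^+ (1 + 1 + false * s1) *: (A1 + (-1) ^+ (s1 && ~~ s2) *: A3)
  + (-1) ^+ (2 + 1 + (false + s1) * s2) *: (A2 + (-1) ^+ (s2 && ~~ s1) *: A4)
  + (-1) ^+ (3 + 1 + (false + s1 + s2) * s3) *:
      (A5 + (-1) ^+ (s3 && ~~ s1) *: A6)
  + (-1) ^+ (1 + 2) *: (A1 - (-1) ^+ (s1 * s2) *: A2)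
  + (-1) ^+ (1 + 3 + s2 * s3) *: (A7 - (-1) ^+ (s1 * s3) *: A5)
  + (-1) ^+ (2 + 3 + s1 * s2 + s1 * s3) *: (A8 - (-1) ^+ (s2 * s3) *: A9)
  = - ((-1) ^+ (s1 * (s2 (+) s3)) *:
     (A8 + (-1) ^+ s2 *: ((-1) ^+ (s1 * (s2 (+) s3)) *: A4)
     - (-1) ^+ (s2 * s3) *:
        (A9 + (-1) ^+ s3 *: ((-1) ^+ (s1 * (s3 (+) s2)) *: A6))
     + (-1) ^+ (s2 * s3) *: - ((-1) ^+ (s1 * (s2 (+) s3)) *:
        (A7 + (-1) ^+ s1 *: ((-1) ^+ (s2 * (s1 (+) s3)) *: A3))))).
Proof.
rewrite -![(-1) ^+ (_ + _)%N]signr_odd -![(-1) ^+ (_ * _)%N]signr_odd.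
rewrite !(oddD, oddM, oddb).
by case: s1 s2 s3 => [] [] []; rewrite /= ?(expr0, expr1, scale1r, scaleN1r,
  opprD, opprK); zmodule.
Qed.

(** This is [H xi2, H xi3] minus the image under H of a combination of d_(H xi2)(xi3),
d_(H xi3)(xi2) and eta. *)
Definition jacL s2 s3 xi2 xi3 eta : L :=
  deriv_op s2 (Hf xi2) xi3 - (-1) ^+ (s2 * s3) *: deriv_op s3 (Hf xi3) xi2
  + (-1) ^+ (s2 * s3) *: Hf eta.

Lemma pairing_jacL xi s2 s3 xi2 xi3 eta : Omega xi ->
  pairing xi (jacL s2 s3 xi2 xi3 eta) =
  pairing xi (deriv_op s2 (Hf xi2) xi3)
  - (-1) ^+ (s2 * s3) *: pairing xi (deriv_op s3 (Hf xi3) xi2)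
  + (-1) ^+ (s2 * s3) *: pairing xi (Hf eta).
Proof.
move=> Oxi; rewrite /jacL pairingDr// (pairingDr (deriv_op _ _ _))//.
by rewrite pairingNr// !pairingZr.
Qed.

(** Existence of eta is integration by parts: it moves the derivatives off u in
xi2((d_u H) xi3). *)
Definition transposed xi2 xi3 eta : Prop :=
  forall s u, inL s u -> pairing xi2 (deriv_op s u xi3) = pairing eta u.

(** Skew-symmetry turns each term where a vector field differentiates some xi_i into
the opposite of another one. What is left are the three derivatives of H; the one
along H xi1 becomes H eta paired with xi1, by transposition and skew-symmetry. The
closure hypothesis is what lets omega_H be evaluated at a bracket. *)
Lemma dform2_jacL s1 s2 s3 xi1 xi2 xi3 eta :
  super_skew H ->
  (forall u v, imH H u -> imH H v -> imH H (bracket u v)) ->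
  Omega xi1 -> inL (~~ s1) xi1 -> Omega xi2 -> inL (~~ s2) xi2 ->
  Omega xi3 -> inL (~~ s3) xi3 -> Omega eta -> inL (~~ (s2 (+) s3)) eta ->
  transposed xi2 xi3 eta ->
  dform2 false (omegaH H) s1 (Hf xi1) s2 (Hf xi2) s3 (Hf xi3) =
  - ((-1) ^+ (s1 * (s2 (+) s3)) *: pairing xi1 (jacL s2 s3 xi2 xi3 eta)).
Proof.
move=> sk cl O1 i1 O2 i2 O3 i3 Oe ie tr.
have [h1 h2 h3] := And3 (inL_image i1) (inL_image i2) (inL_image i3).
have om xi xi' xi'' : Omega xi -> Omega xi' -> Omega xi'' ->
    omegaH H (bracket (Hf xi) (Hf xi')) (Hf xi'') =
    pairing xi'' (bracket (Hf xi) (Hf xi')).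
  move=> O O' O''; have [||zeta Oz <-] := cl (Hf xi) (Hf xi').
  - by exists xi.
  - by exists xi'.
  by rewrite omegaHE.
rewrite /dform2 !om// !omegaHE//.
rewrite (act_pairing h1 h2)// (act_pairing h2 h1)// (act_pairing h3 h1)//.
rewrite (bracketE h1 h2) (bracketE h1 h3) (bracketE h2 h3).
rewrite pairing_jacL// (pairing_deriv_op sk O1 i1 O3 i3 h2).
rewrite (pairing_deriv_op sk O1 i1 O2 i2 h3).
rewrite (sk (~~ s1) (~~ (s2 (+) s3)) xi1 eta)// !addbT !negbK.
rewrite -(tr _ _ h1) (pairing_deriv_op sk O2 i2 O3 i3 h1).
rewrite !(pairingDr, pairingNr, pairingZr)//.
exact: dform2_signs.
Qed.

Lemma mdo_entryZ i p q (r : R) (x : A) :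
  mdo_entry H i p q (r *: x) = r *: mdo_entry H i p q x.
Proof.
rewrite /mdo_entry scaler_sumr; apply: eq_bigr => l _.
by rewrite iterDZ scalerAr.
Qed.

Lemma mdo_funZ (r : R) xi : Omega xi -> Hf (r *: xi) = r *: Hf xi.
Proof.
move=> /OmegaP[X HX]; apply/funext => p; rewrite famZ !(@mdo_funE _ _ _ _ X) //.
  rewrite scaler_sumr; apply: eq_bigr => i _; rewrite scaler_sumr.
  apply: eq_bigr => q _; rewrite -mdo_entryZ; congr (mdo_entry _ _ _ _ _).
  exact: partZ.
move=> q; rewrite famZ => h; apply: HX.
by apply: contraNN h => /eqP ->; rewrite scaler0.
Qed.

Lemma bracket_in_image s2 s3 xi2 xi3 eta :
  Omega xi2 -> inL (~~ s2) xi2 -> Omega xi3 -> inL (~~ s3) xi3 -> Omega eta ->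
  jacL s2 s3 xi2 xi3 eta = 0 -> imH H (bracket (Hf xi2) (Hf xi3)).
Proof.
move=> O2 i2 O3 i3 Oe J.
have [h2 h3] := (inL_image i2, inL_image i3).
have [O23 O32] := (dL_Omega h2 O3, dL_Omega h3 O2).
pose e : R := (-1) ^+ (s2 * s3).
have Oa := OmegaZ ((-1) ^+ s2) O23.
have Ob := OmegaZ (- (e * (-1) ^+ s3)) O32; have Oc := OmegaZ (- e) Oe.
exists ((-1) ^+ s2 *: dL (Hf xi2) xi3
        + (- (e * (-1) ^+ s3)) *: dL (Hf xi3) xi2 + (- e) *: eta).
  exact: OmegaD (OmegaD Oa Ob) Oc.
rewrite (mdo_funD H (OmegaD Oa Ob) Oc) (mdo_funD H Oa Ob).
rewrite !mdo_funZ// (bracketE h2 h3) -/e.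
move: J; rewrite /jacL /deriv_op -/e => /eqP; rewrite addr_eq0 => /eqP J.
have collect (M : lmodType R) (b1 b2 b3 b4 : M) (r r' : R) :
    r *: b2 + - (e * r') *: b4 + (b1 - r *: b2 - e *: (b3 - r' *: b4))
    = b1 - e *: b3.
  by rewrite scalerBr scaleNr scalerA; zmodule.
by rewrite [- e *: Hf eta]scaleNr -J collect.
Qed.

End Closedness.

(** * Linear extension from the basis and simple tensors *)

Section LinearExtension.
Variables (R : realType) (I : choiceType).
Local Notation V := {freeg I / R}.

Lemma freeg_lin_ind (P : V -> Prop) :
  P 0 -> (forall x y, P x -> P y -> P (x + y)) ->
  (forall (r : R) x, P x -> P (r *: x)) -> (forall q, P << q >>) ->
  forall x, P x.
Proof.
move=> P0 PD PZ PU; elim/freeg_ind_dom0 => // k q x _ _ Px; apply: PD => //.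
suff -> : << k *g q >> = k *: << q >> :> V by apply/PZ/PU.
by apply/eqP/freeg_eqP => i; rewrite coeffZ !coeffU mul1r.
Qed.

Section Ev.
Variable M : lmodType R.
Implicit Types (u : I -> M) (x y : V).

Lemma fglift_sub u x y : fglift u (x - y) = fglift u x - fglift u y.
Proof. exact: lift_is_additive. Qed.

Lemma fglift0 u : fglift u 0 = 0.
Proof. by rewrite -(subrr (0 : V)) fglift_sub subrr. Qed.

Lemma fgliftN u x : fglift u (- x) = - fglift u x.
Proof. by rewrite -sub0r fglift_sub fglift0 sub0r. Qed.

Lemma fgliftD u x y : fglift u (x + y) = fglift u x + fglift u y.
Proof. by rewrite -[y in LHS]opprK fglift_sub fgliftN opprK. Qed.

Lemma fgliftU u q : fglift u << q >> = u q.
Proof. by rewrite liftU scale1r. Qed.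

Lemma fgliftZ u (r : R) x : fglift u (r *: x) = r *: fglift u x.
Proof.
elim/freeg_ind_dom0: x => [|k q x _ _ IH].
  by rewrite scaler0 fglift0 scaler0.
rewrite scalerDr !fgliftD IH scalerDr; congr (_ + _).
suff -> : r *: << k *g q >> = << r * k *g q >> :> V by rewrite !liftU scalerA.
by apply/eqP/freeg_eqP => i; rewrite coeffZ !coeffU mulrA.
Qed.

Lemma fglift_sum (T : Type) (r : seq T) (x : T -> V) u :
  fglift u (\sum_(t <- r) x t) = \sum_(t <- r) fglift u (x t).
Proof. by elim/big_rec2: _ => [|t y z _ <-]; rewrite ?fglift0 ?fgliftD. Qed.

Lemma fglift_addl u u' x :
  fglift (fun i => u i + u' i) x = fglift u x + fglift u' x.
Proof.
elim/freeg_lin_ind: x => [|x y Hx Hy|r x Hx|q].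
- by rewrite !fglift0 addr0.
- by rewrite !fgliftD Hx Hy addrACA.
- by rewrite !fgliftZ Hx scalerDr.
- by rewrite !fgliftU.
Qed.

Lemma fglift_scalel (r : R) u x : fglift (fun i => r *: u i) x = r *: fglift u x.
Proof.
elim/freeg_lin_ind: x => [|x y Hx Hy|k x Hx|q].
- by rewrite !fglift0 scaler0.
- by rewrite !fgliftD Hx Hy scalerDr.
- by rewrite !fgliftZ Hx !scalerA mulrC.
- by rewrite !fgliftU.
Qed.

End Ev.

Lemma addZ_linear (M N : lmodType R) (h : M -> N) :
  {morph h : x y / x + y} -> (forall (r : R) x, h (r *: x) = r *: h x) -> linear h.
Proof. by move=> hD hZ r x y; rewrite hD hZ. Qed.

Lemma linear_addZ (M N : lmodType R) (h : M -> N) : linear h ->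
  ({morph h : x y / x + y}) * (forall (r : R) x, h (r *: x) = r *: h x).
Proof.
move=> hl; have hD : {morph h : x y / x + y}.
  by move=> x y; have := hl 1 x y; rewrite !scale1r.
split=> // r x; have := hl r x 0; rewrite !addr0.
have -> : h 0 = 0 by apply: (addrI (h 0)); rewrite -hD !addr0.
by rewrite addr0.
Qed.

Lemma bilinear_fglift2 (M : lmodType R) (m : I -> I -> M) :
  bilinear_map (fun u v : V => fglift (fun al => fglift (m al) v) u).
Proof.
split=> [u|v]; apply: addZ_linear.
- move=> v w; rewrite -fglift_addl; congr (fglift _ u).
  by apply/funext => al; rewrite fgliftD.
- move=> r v; rewrite -fglift_scalel; congr (fglift _ u).
  by apply/funext => al; rewrite fgliftZ.
- by move=> u w; rewrite fgliftD.
- by move=> r u; rewrite fgliftZ.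
Qed.

Lemma bilin_op_bilinear (m : I -> I -> I -> R) : bilinear_map (bilin_op m).
Proof. exact: bilinear_fglift2. Qed.

Lemma bilin_form_bilinear (a : I -> I -> R) :
  bilinear_map (bilin_form a : V -> V -> R^o).
Proof. exact: (@bilinear_fglift2 R^o). Qed.

End LinearExtension.

Section Singles.
Variables (R : realType) (I : choiceType).
Local Notation A := (superalg R I).
Local Notation L := (I -> A).
Local Notation V := {freeg I / R}.
Local Notation D := (@D R I).
Implicit Types (s t : bool) (u v xi eta : L) (x y : V) (f g : A).

(** The simple tensor x (x) f of Omega = V (x) A. *)
Definition tens x f : L := fun i => coeff i x *: f.

Lemma tensD x y f : tens (x + y) f = tens x f + tens y f.
Proof. by apply/funext => i; rewrite /tens coeffD scalerDl. Qed.

Lemma tensZ (r : R) x f : tens (r *: x) f = r *: tens x f.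
Proof. by apply/funext => i; rewrite /tens coeffZ famZ scalerA. Qed.

Lemma tens0 f : tens 0 f = 0.
Proof. by apply/funext => i; rewrite /tens coeff0 scale0r. Qed.

Lemma tensU q f i : tens << q >> f i = if i == q then f else 0.
Proof.
by rewrite /tens coeffU mul1r eq_sym; case: eqP; rewrite ?scale1r ?scale0r.
Qed.

Lemma Omega_tens x f : Omega (tens x f).
Proof.
apply/OmegaP; exists (seq_fset tt (dom x)) => q; rewrite seq_fsetE mem_dom.
by apply: contraNN => /eqP; rewrite /tens => ->; rewrite scale0r.
Qed.

Lemma inL_tens s x f : homog s f -> inL (~~ s) (tens x f).
Proof. by move=> hf i; rewrite negbK; exact: homogZ. Qed.

Lemma homog_ind_Omega s (P : L -> Prop) :
  P 0 ->
  (forall xi eta, Omega xi -> Omega eta -> inL (~~ s) xi -> inL (~~ s) eta ->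
     P xi -> P eta -> P (xi + eta)) ->
  (forall q f, homog s f -> P (tens << q >> f)) ->
  forall xi, Omega xi -> inL (~~ s) xi -> P xi.
Proof.
move=> P0 PD PU xi /OmegaP[X HX] hxi.
have hq q : homog s (xi q) by have := hxi q; rewrite negbK.
have -> : xi = \sum_(q <- X) tens << q >> (xi q).
  apply/funext => i.
  have -> : (\sum_(q <- X) tens << q >> (xi q)) i =
            \sum_(q <- X) tens << q >> (xi q) i.
    by elim/big_rec2: _ => // q y1 y2 _ <-.
  under eq_bigr do rewrite tensU.
  case: (boolP (i \in X)) => [iX|iX].
    rewrite (big_fsetD1 i) //= eqxx big1_fset ?addr0// => q.
    by rewrite !inE eq_sym => /andP[/negPf ->].
  rewrite (contraNeq (HX i) iX) big1_fset // => q qX _.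
  by case: eqP => // iq; rewrite iq qX in iX.
suff [] : [/\ Omega (\sum_(q <- X) tens << q >> (xi q)),
   inL (~~ s) (\sum_(q <- X) tens << q >> (xi q)) &
   P (\sum_(q <- X) tens << q >> (xi q))] by [].
elim: (X : seq I) => [|q r [O i Pr]].
  by rewrite big_nil; split=> //; [exact: Omega0 | exact: inL0].
have [Oq iq] := (Omega_tens << q >> (xi q), inL_tens << q >> (hq q)).
rewrite big_cons; split; [exact: OmegaD | exact: inLD | apply: PD => //].
exact: PU.
Qed.

(** Pairing is defined by coordinates; here it becomes independent of the basis, u
being extended linearly to V. *)
Lemma pairing_tens x f u : pairing (tens x f) u = tilde (fglift u x * f).
Proof.
elim/freeg_lin_ind: x => [|x y Hx Hy|r x Hx|q].
- rewrite fglift0 mul0r tilde0 tens0 /pairing fsbig1// => q _.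
  by rewrite mulr0 tilde0.
- rewrite tensD pairingDl; try exact: Omega_tens.
  by rewrite Hx Hy fgliftD mulrDl tildeD.
- rewrite tensZ fgliftZ -scalerAl tildeZ -Hx /pairing.
  have [X HX] := iffLR (OmegaP _) (Omega_tens x f).
  rewrite -[LHS]/(pairing _ u) -[\sum_(_ \in _) _]/(pairing _ u).
  rewrite !(pairingE (X := X)) //.
    rewrite scaler_sumr; apply: eq_bigr => q _.
    by rewrite famZ -scalerAr tildeZ.
  move=> q; rewrite famZ => h; apply: HX.
  by apply: contraNN h => /eqP ->; rewrite scaler0.
- rewrite fgliftU (pairingE (X := [fset q]%fset)).
    by rewrite big_seq_fset1 tensU eqxx.
  by move=> i; rewrite tensU inE; case: (eqVneq i q) => // _; rewrite eqxx.
Qed.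

Lemma dL_tens s u x f : inL s u -> dL u (tens x f) = tens x (dvec u f).
Proof. by move=> us; apply/funext => i; rewrite /dL /tens (dvec_scale us). Qed.

(** Integration by parts modulo D(A). *)
Lemma tilde_parts s f g : homog s f ->
  tilde (D f * g) = - ((-1) ^+ s *: tilde (f * D g)).
Proof.
move=> hf; apply/eqP; rewrite -addr_eq0 -tildeZ -tildeD -(DM _ hf) -tilde0.
by apply/eqP/tildeP; exists (f * g); rewrite subr0.
Qed.

End Singles.

(** * Reduction to simple tensors *)

Section Reduction.
Variables (R : realType) (I : choiceType).
Local Notation A := (superalg R I).
Local Notation L := (I -> A).
Local Notation V := {freeg I / R}.
Implicit Types (s t : bool) (u v xi eta : L).
Variable H : mdo R I true.
Local Notation "'Hf'" := (mdo_fun H).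

Lemma dL_0l (v : L) : dL (0 : L) v = 0.
Proof.
by apply/funext => q; rewrite /dL (dvec_inL _ (@inL0 R I true)) dvec_h0.
Qed.

Lemma mdo_fun0 : Hf 0 = 0.
Proof. by rewrite -(scale0r (0 : L)) mdo_funZ ?scale0r//; exact: Omega0. Qed.

Lemma dL_0r s u : inL s u -> dL u (0 : L) = 0.
Proof. by move=> us; apply/funext => q; exact: (dvec_0 us). Qed.

Lemma deriv_op_add s u xi xi' : inL s u -> Omega xi -> Omega xi' ->
  deriv_op H s u (xi + xi') = deriv_op H s u xi + deriv_op H s u xi'.
Proof.
move=> us O O'; rewrite /deriv_op mdo_funD// !(dL_add _ _ us).
rewrite (mdo_funD H (dL_Omega us O) (dL_Omega us O')).
by rewrite scalerDr opprD addrACA.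
Qed.

Lemma deriv_op_addl s u u' xi : inL s u -> inL s u' -> Omega xi ->
  deriv_op H s (u + u') xi = deriv_op H s u xi + deriv_op H s u' xi.
Proof.
move=> us us' O; rewrite /deriv_op !(dL_addl _ us us').
rewrite (mdo_funD H (dL_Omega us O) (dL_Omega us' O)).
by rewrite scalerDr opprD addrACA.
Qed.

Lemma deriv_op_0r s u : inL s u -> deriv_op H s u 0 = 0.
Proof.
by move=> us; rewrite /deriv_op mdo_fun0 !(dL_0r us) mdo_fun0 scaler0 subr0.
Qed.

Lemma deriv_op_0l s xi : deriv_op H s 0 xi = 0.
Proof. by rewrite /deriv_op !dL_0l mdo_fun0 scaler0 subr0. Qed.

Lemma pairing0l u : pairing (0 : L) u = 0.
Proof. by rewrite /pairing fsbig1// => q _; rewrite mulr0 tilde0. Qed.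

Lemma pairing0r xi : pairing xi (0 : L) = 0.
Proof. by rewrite /pairing fsbig1// => q _; rewrite mul0r tilde0. Qed.

(** The condition under which [dform2_jacL] gives closedness and [bracket_in_image] gives
a bracket in the image. The existential over eta makes it additive in both arguments,
which allows the reduction to simple tensors. *)
Definition jacL_solvable s2 s3 xi2 xi3 : Prop :=
  exists eta, [/\ Omega eta, inL (~~ (s2 (+) s3)) eta,
    transposed H xi2 xi3 eta & jacL H s2 s3 xi2 xi3 eta = 0].

Lemma jacL_solvable_addl s2 s3 xi xi' xi3 :
  Omega xi -> Omega xi' -> Omega xi3 ->
  inL (~~ s2) xi -> inL (~~ s2) xi' -> inL (~~ s3) xi3 ->
  jacL_solvable s2 s3 xi xi3 -> jacL_solvable s2 s3 xi' xi3 ->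
  jacL_solvable s2 s3 (xi + xi') xi3.
Proof.
move=> O O' O3 i i' i3 [e [Oe ie te je]] [e' [Oe' ie' te' je']].
exists (e + e'); split; [exact: OmegaD | exact: inLD | |].
  by move=> s u us; rewrite pairingDl// pairingDl// te// te'.
have [h h' h3] := And3 (inL_image H i) (inL_image H i') (inL_image H i3).
rewrite -[RHS]addr0 -{1}je -je' /jacL mdo_funD// (deriv_op_addl h h')//.
rewrite (deriv_op_add h3)// mdo_funD// !scalerDr opprD.
by rewrite [X in X + _ = _]addrACA [LHS]addrACA.
Qed.

Lemma jacL_solvable_addr s2 s3 xi2 xi xi' :
  Omega xi2 -> Omega xi -> Omega xi' ->
  inL (~~ s2) xi2 -> inL (~~ s3) xi -> inL (~~ s3) xi' ->
  jacL_solvable s2 s3 xi2 xi -> jacL_solvable s2 s3 xi2 xi' ->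
  jacL_solvable s2 s3 xi2 (xi + xi').
Proof.
move=> O2 O O' i2 i i' [e [Oe ie te je]] [e' [Oe' ie' te' je']].
exists (e + e'); split; [exact: OmegaD | exact: inLD | |].
  by move=> s u us; rewrite pairingDl// (deriv_op_add us)// pairingDr// te// te'.
have [h h' h2] := And3 (inL_image H i) (inL_image H i') (inL_image H i2).
rewrite -[RHS]addr0 -{1}je -je' /jacL [Hf (xi + _)]mdo_funD// (deriv_op_addl h h')//.
rewrite (deriv_op_add h2)// mdo_funD// !scalerDr opprD.
by rewrite [X in X + _ = _]addrACA [LHS]addrACA.
Qed.

Lemma jacL_solvable_all s2 s3 :
  (forall p q (f g : A), homog s2 f -> homog s3 g ->
     jacL_solvable s2 s3 (tens << p >> f) (tens << q >> g)) ->
  forall xi2 xi3, Omega xi2 -> inL (~~ s2) xi2 -> Omega xi3 ->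
    inL (~~ s3) xi3 -> jacL_solvable s2 s3 xi2 xi3.
Proof.
move=> base xi2 xi3 O2 i2 O3 i3.
move: xi2 O2 i2; apply: homog_ind_Omega.
- exists 0; split; [exact: Omega0 | exact: inL0 | |].
    by move=> s u us; rewrite !pairing0l.
  rewrite /jacL mdo_fun0 deriv_op_0l (deriv_op_0r (inL_image H i3)).
  by rewrite !scaler0 subrr addr0.
- by move=> xi xi' O O' i i'; exact: jacL_solvable_addl.
move=> p f hf; have [Op ip] := (Omega_tens << p >> f, inL_tens << p >> hf).
move: xi3 O3 i3; apply: homog_ind_Omega.
- exists 0; split; [exact: Omega0 | exact: inL0 | |].
    by move=> s u us; rewrite (deriv_op_0r us) pairing0l pairing0r.
  rewrite /jacL mdo_fun0 deriv_op_0l (deriv_op_0r (inL_image H ip)).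
  by rewrite !scaler0 subrr addr0.
- by move=> xi xi' O O' i i'; exact: jacL_solvable_addr.
by move=> q g hg; exact: base.
Qed.

Lemma mdo_fun_Lpart s xi : Omega xi -> Hf (Lpart (~~ s) xi) = Lpart s (Hf xi).
Proof.
move=> O; rewrite -[xi in RHS]sum_Lpart mdo_funD; try exact: Omega_part.
rewrite LpartD !(Lpart_of_inL _ (mdo_inL H (Lpart_in _ xi))) !addbT.
by case: s; rewrite /= ?(addr0, add0r).
Qed.

Lemma imH_homog s x : imH H x -> inL s x ->
  exists xi, [/\ Omega xi, inL (~~ s) xi & Hf xi = x].
Proof.
move=> [xi O <-] hx; exists (Lpart (~~ s) xi).
split; [exact: Omega_part | exact: Lpart_in |].
by rewrite mdo_fun_Lpart// (Lpart_of_inL _ hx) eqxx.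
Qed.

Lemma imH_subalgebra :
  (forall s2 s3 xi2 xi3, Omega xi2 -> inL (~~ s2) xi2 -> Omega xi3 ->
    inL (~~ s3) xi3 -> jacL_solvable s2 s3 xi2 xi3) ->
  is_subalgebra (imH H).
Proof.
move=> sol; have imD u v : imH H u -> imH H v -> imH H (u + v).
  move=> [xi O <-] [xi' O' <-]; exists (xi + xi'); first exact: OmegaD.
  exact: mdo_funD.
split=> //.
- by exists 0; [exact: Omega0 | exact: mdo_fun0].
- move=> r u [xi O <-]; exists (r *: xi); first exact: OmegaZ.
  exact: mdo_funZ.
move=> u v [xi O <-] [xi' O' <-].
have part s t : imH H (bracket (Lpart s (Hf xi)) (Lpart t (Hf xi'))).
  rewrite -!mdo_fun_Lpart//.
  have [e [Oe _ _ je]] := sol s t _ _ (Omega_part (~~ s) O)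
    (Lpart_in (~~ s) xi) (Omega_part (~~ t) O') (Lpart_in (~~ t) xi').
  apply: (bracket_in_image _ _ _ _ Oe je); try exact: Omega_part; exact: Lpart_in.
have -> : bracket (Hf xi) (Hf xi') = \sum_(s : bool) \sum_(t : bool)
    bracket (Lpart s (Hf xi)) (Lpart t (Hf xi')).
  apply/funext => q; rewrite !big_bool /=.
  have E s t : bracket (Lpart s (Hf xi)) (Lpart t (Hf xi')) q =
     dvec (Lpart s (Hf xi)) (Lpart t (Hf xi') q)
     - (-1) ^+ (s * t) *: dvec (Lpart t (Hf xi')) (Lpart s (Hf xi) q).
    by rewrite (bracketE (Lpart_in _ _) (Lpart_in _ _)).
  by rewrite !famD !E /bracket !big_bool.
by rewrite !big_bool; apply: (imD); apply: (imD); exact: part.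
Qed.

End Reduction.

(** * The operator on simple tensors *)

Section TheOperator.
Variables (R : realType) (I : choiceType).
Variables (a : I -> I -> R) (b c d : I -> I -> I -> R).
Hypothesis hb : forall al be, finite_set [set ga | b al be ga != 0].
Hypothesis hc : forall al be, finite_set [set ga | c al be ga != 0].
Hypothesis hd : forall al be, finite_set [set ga | d al be ga != 0].
Local Notation A := (superalg R I).
Local Notation L := (I -> A).
Local Notation V := {freeg I / R}.
Local Notation D := (@D R I).
Implicit Types (s t : bool) (u v xi eta : L) (x y z : V) (f g : A).

Local Notation "x '*b' y" := (bilin_op b x y) (at level 40).
Local Notation "x '*c' y" := (bilin_op c x y) (at level 40).
Local Notation "x '*d' y" := (bilin_op d x y) (at level 40).

(** The extension of Phi_i(n) to a linear function of a vector of V. *)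
Definition field (n : nat) (x : V) : A := fglift (fun i => Phi R i n) x.

Lemma field_bilin_op (m : I -> I -> I -> R) al be n :
  finite_set [set ga | m al be ga != 0] ->
  field n (bilin_op m << al >> << be >>) =
  \sum_(ga \in [set: I]) m al be ga *: Phi R ga n.
Proof.
move=> fm; have mX ga : m al be ga != 0 -> ga \in fset_set [set k | m al be k != 0].
  by move=> h; rewrite in_fset_set//; exact: mem_set.
rewrite bilin_opE !(fsbig_sub (X := fset_set [set k | m al be k != 0])).
- by rewrite /field fglift_sum; apply: eq_bigr => ga _; rewrite liftU.
- by move=> ga h; apply: mX; apply: contraNN h => /eqP ->; rewrite scale0r.
- move=> ga h; apply: mX; apply: contraNN h => /eqP ->.
  by apply/freeg_eqP => i; rewrite coeffU coeff0 mul0r.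
Qed.

Lemma homog_field n x : (0 < n)%N -> homog (odd n) (field n x).
Proof.
move=> n0; rewrite /field; elim/freeg_lin_ind: x => [|x y Hx Hy|r x Hx|q].
- by rewrite fglift0; exact: homog0.
- by rewrite fgliftD; exact: homogD.
- by rewrite fgliftZ; exact: homogZ.
- by rewrite fgliftU; exact: homog_Phi.
Qed.

Lemma D_field n x : (0 < n)%N -> D (field n x) = field n.+1 x.
Proof.
move=> n0; rewrite /field; elim/freeg_lin_ind: x => [|x y Hx Hy|r x Hx|q].
- by rewrite !fglift0 D0.
- by rewrite !fgliftD DD Hx Hy.
- by rewrite !fgliftZ DZ Hx.
- by rewrite !fgliftU D_Phi.
Qed.

Lemma dvec_field s u n x : inL s u ->
  dvec u (field n.+1 x) = (-1) ^+ (s * n) *: iter n D (fglift u x).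
Proof.
move=> us; rewrite /field; elim/freeg_lin_ind: x => [|x y Hx Hy|r x Hx|q].
- by rewrite !fglift0 (dvec_0 us) iterD0 scaler0.
- by rewrite !fgliftD (dvec_add us) iterDD scalerDr Hx Hy.
- by rewrite !fgliftZ (dvec_scale us) iterDZ Hx !scalerA mulrC.
- by rewrite !fgliftU (dvec_Phi us).
Qed.

Lemma order_le_field j n x : (0 < n)%N -> order_le j n (field n x).
Proof.
move=> n0; rewrite /field; elim/freeg_lin_ind: x => [|x y Hx Hy|r x Hx|q].
- by rewrite fglift0 => m _; exact: dPhi0.
- by rewrite fgliftD; exact: order_leD.
- by rewrite fgliftZ; exact: order_leZ.
- by rewrite fgliftU; exact: order_le_Phi.
Qed.

Lemma coeff_field n x i : (0 < n)%N -> dPhi i n (field n x) = (coeff i x)%:A.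
Proof.
move=> n0; rewrite /field; elim/freeg_lin_ind: x => [|x y Hx Hy|r x Hx|q].
- by rewrite fglift0 dPhi0 coeff0 scale0r.
- by rewrite fgliftD dPhiD Hx Hy coeffD scalerDl.
- by rewrite fgliftZ dPhiZ Hx coeffZ scalerA.
- by rewrite fgliftU dPhi_Phi// eqxx andbT coeffU mul1r scaler_nat.
Qed.

Lemma scalar_inj (r : R) : r%:A = 0 :> A -> r = 0.
Proof. by move=> /eqP; rewrite scaler_eq0 oner_eq0 orbF => /eqP. Qed.

Lemma field_inj n x : (0 < n)%N -> field n x = 0 -> x = 0.
Proof.
move=> n0 x0; apply/eqP/freeg_eqP => i; rewrite coeff0; apply: scalar_inj.
by rewrite -(coeff_field x i n0) x0 dPhi0.
Qed.

Definition entry := op_entry D field (bilin_form a)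
  (bilin_op b) (bilin_op c) (bilin_op d).

Lemma Hop_op_entry i al be f :
  mdo_entry (Hop a b c d) i al be f = entry << al >> << be >> f.
Proof.
rewrite /mdo_entry /= !big_ord_recl big_ord0 /= !mul0r !addr0 !add0r.
rewrite /entry /op_entry !field_bilin_op// bilin_formE mulr_algl.
rewrite [LHS]addrC; congr (_ + _); rewrite [LHS]addrC; congr (_ + _).
by rewrite [LHS]addrC.
Qed.

Lemma bilin_op_addl m x y z : bilin_op m (x + y) z = bilin_op m x z + bilin_op m y z.
Proof. by have [_ /(_ z)/linear_addZ[->]] := bilin_op_bilinear m. Qed.
Lemma bilin_op_addr m x y z : bilin_op m z (x + y) = bilin_op m z x + bilin_op m z y.
Proof. by have [/(_ z)/linear_addZ[->]] := bilin_op_bilinear m. Qed.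
Lemma bilin_op_scalel m (r : R) x z : bilin_op m (r *: x) z = r *: bilin_op m x z.
Proof. by have [_ /(_ z)/linear_addZ[_ ->]] := bilin_op_bilinear m. Qed.
Lemma bilin_op_scaler m (r : R) x z : bilin_op m z (r *: x) = r *: bilin_op m z x.
Proof. by have [/(_ z)/linear_addZ[_ ->]] := bilin_op_bilinear m. Qed.

Lemma bilin_form_addl x y z :
  bilin_form a (x + y) z = bilin_form a x z + bilin_form a y z.
Proof. by have [_ /(_ z)/linear_addZ[->]] := bilin_form_bilinear a. Qed.
Lemma bilin_form_addr x y z :
  bilin_form a z (x + y) = bilin_form a z x + bilin_form a z y.
Proof. by have [/(_ z)/linear_addZ[->]] := bilin_form_bilinear a. Qed.
Lemma bilin_form_scalel (r : R) x z :
  bilin_form a (r *: x) z = r * bilin_form a x z.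
Proof. by have [_ /(_ z)/linear_addZ[_ ->]] := bilin_form_bilinear a. Qed.
Lemma bilin_form_scaler (r : R) x z :
  bilin_form a z (r *: x) = r * bilin_form a z x.
Proof. by have [/(_ z)/linear_addZ[_ ->]] := bilin_form_bilinear a. Qed.

Lemma fieldD n : {morph field n : x y / x + y}.
Proof. by move=> x y; exact: fgliftD. Qed.
Lemma fieldN n : {morph field n : x / - x}.
Proof. by move=> x; exact: fgliftN. Qed.
Lemma fieldZ n (r : R) x : field n (r *: x) = r *: field n x.
Proof. exact: fgliftZ. Qed.
Lemma field0 n : field n 0 = 0.
Proof. exact: fglift0. Qed.

Lemma entry_addl x y z f : entry (x + y) z f = entry x z f + entry y z f.
Proof.
rewrite /entry /op_entry !bilin_op_addl bilin_form_addl !fieldD.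
by rewrite scalerDl !mulrDl; rewrite [RHS]addrACA [X in _ = X + _]addrACA
  [X in _ = X + _ + _]addrACA.
Qed.

Lemma entry_addr x y z f : entry z (x + y) f = entry z x f + entry z y f.
Proof.
rewrite /entry /op_entry !bilin_op_addr bilin_form_addr !fieldD.
by rewrite scalerDl !mulrDl; rewrite [RHS]addrACA [X in _ = X + _]addrACA
  [X in _ = X + _ + _]addrACA.
Qed.

Lemma entry_scalel (r : R) x z f : entry (r *: x) z f = r *: entry x z f.
Proof.
rewrite /entry /op_entry !bilin_op_scalel bilin_form_scalel !fieldZ.
by rewrite -scalerA -!scalerAl -!scalerDr.
Qed.

Lemma entry_scaler (r : R) x z f : entry z (r *: x) f = r *: entry z x f.
Proof.
rewrite /entry /op_entry !bilin_op_scaler bilin_form_scaler !fieldZ.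
by rewrite -scalerA -!scalerAl -!scalerDr.
Qed.

Lemma entry0l z f : entry 0 z f = 0.
Proof. by rewrite -(scale0r 0) entry_scalel scale0r. Qed.
Lemma entry0r z f : entry z 0 f = 0.
Proof. by rewrite -(scale0r 0) entry_scaler scale0r. Qed.

Local Notation Hf := (mdo_fun (Hop a b c d)).

Lemma Hop_tens s x f al : homog s f -> Hf (tens x f) al = entry << al >> x f.
Proof.
move=> hf; elim/freeg_lin_ind: x => [|x y Hx Hy|r x Hx|q].
- by rewrite tens0 mdo_fun0 entry0r.
- by rewrite tensD mdo_funD ?famD ?Hx ?Hy ?entry_addr//; exact: Omega_tens.
- by rewrite tensZ mdo_funZ ?famZ ?Hx ?entry_scaler//; exact: Omega_tens.
rewrite (@mdo_funE _ _ _ _ [fset q]%fset); last first.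
  by move=> i; rewrite tensU inE; case: (eqVneq i q) => // _; rewrite eqxx.
have E i : Lpart i (tens << q >> f) q = if ~~ s == i then f else 0.
  by rewrite (Lpart_of_inL _ (inL_tens _ hf)); case: eqP; rewrite ?tensU ?eqxx.
rewrite big_bool /= !big_seq_fset1 !E.
by case: s {hf E} => /=; rewrite mdo_entry0 ?addr0 ?add0r Hop_op_entry.
Qed.

Lemma fglift_Hop s x f (v : V) :
  homog s f -> fglift (Hf (tens x f)) v = entry v x f.
Proof.
move=> hf; elim/freeg_lin_ind: v => [|v w Hv Hw|r v Hv|q].
- by rewrite fglift0 entry0l.
- by rewrite fgliftD Hv Hw entry_addl.
- by rewrite fgliftZ Hv entry_scalel.
- by rewrite fgliftU (Hop_tens _ _ hf).
Qed.

Lemma deriv_op_tens s t u y g al : inL s u -> homog t g ->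
  deriv_op (Hop a b c d) s u (tens y g) al =
  fglift u (<< al >> *b y) * iter 2 D g
  + (-1) ^+ s *: (D (fglift u (<< al >> *c y)) * D g)
  + iter 2 D (fglift u (<< al >> *d y)) * g.
Proof.
move=> us tg; rewrite /deriv_op (dL_tens _ _ us).
rewrite -[LHS]/(dvec u (Hf (tens y g) al)
  - (-1) ^+ s *: Hf (tens y (dvec u g)) al).
rewrite (Hop_tens _ _ tg) (Hop_tens _ _ (homog_dvec us tg)) /entry /op_entry.
set w1 := << al >> *b y; set w2 := << al >> *c y; set w3 := << al >> *d y.
rewrite !(dvec_add us) (dvec_scale us) !(dvec_iterD us).
rewrite !(dvec_mul us _ (homog_field _ _)) // !(dvec_field _ _ us).
rewrite (dvec_D us) !(dvec_iterD us).
rewrite -![(-1) ^+ (_ * _)%N]signr_odd !(oddM, oddb) /=.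
move: (dvec u g) (fglift u w1) (fglift u w2) (fglift u w3) => g' u1 u2 u3.
by case: (s); rewrite /= ?(expr0, expr1, scale1r, scaleN1r, mulrN, scalerN,
  opprD, opprK, mulNr, scalerDr); zmodule.
Qed.

Lemma fglift_deriv_op_tens s t u y g (v : V) : inL s u -> homog t g ->
  fglift (deriv_op (Hop a b c d) s u (tens y g)) v =
  fglift u (v *b y) * iter 2 D g + (-1) ^+ s *: (D (fglift u (v *c y)) * D g)
  + iter 2 D (fglift u (v *d y)) * g.
Proof.
move=> us tg; elim/freeg_lin_ind: v => [|v w Hv Hw|r v Hv|q].
- rewrite -(scale0r (0 : V)) !bilin_op_scalel !fgliftZ !iterDZ DZ -!scalerAl.
  by rewrite !scale0r scaler0 !addr0.
- rewrite fgliftD Hv Hw !bilin_op_addl !fgliftD !iterDD DD !mulrDl scalerDr.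
  by rewrite [LHS]addrACA [X in X + _ = _]addrACA.
- rewrite fgliftZ Hv !bilin_op_scalel !fgliftZ !iterDZ DZ -!scalerAl.
  by rewrite scalerA mulrC -scalerA -!scalerDr.
- by rewrite fgliftU (deriv_op_tens _ _ us tg).
Qed.

Lemma homog_fglift s u x : inL s u -> homog (~~ s) (fglift u x).
Proof.
move=> us; elim/freeg_lin_ind: x => [|x y Hx Hy|r x Hx|q].
- by rewrite fglift0; exact: homog0.
- by rewrite fgliftD; exact: homogD.
- by rewrite fgliftZ; exact: homogZ.
- by rewrite fgliftU; exact: us.
Qed.

(** Obtained by moving the derivatives off u in the three terms of [deriv_op_tens]; the
second and third pick up the signs (-1)^s (-1)^s = 1 and -1. *)
Definition transpose_tens (x y : V) f g : L :=
  tens (x *b y) (iter 2 D g * f) + tens (x *c y) (D (D g * f))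
  + tens (x *d y) (- iter 2 D (g * f)).

Lemma Omega_transpose_tens x y f g : Omega (transpose_tens x y f g).
Proof. by apply: OmegaD (OmegaD _ _) _; exact: Omega_tens. Qed.

Lemma inL_transpose_tens s t x y f g : homog s f -> homog t g ->
  inL (~~ (s (+) t)) (transpose_tens x y f g).
Proof.
move=> hf hg.
have h1 : homog (s (+) t) (iter 2 D g * f).
  by rewrite addbC; apply: homogM => //; exact: (homog_iterD 2 hg).
have h2 : homog (s (+) t) (D (D g * f)).
  apply: (@homog_eq _ _ (~~ (~~ t (+) s))); first by case: (s) (t) => [] [].
  by apply: homog_D; apply: homogM => //; exact: homog_D.
have h3 : homog (s (+) t) (- iter 2 D (g * f)).
  apply: homogN; rewrite addbC.
  exact: (homog_iterD 2 (homogM hg hf)).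
by apply: inLD (inLD _ _) _; exact: inL_tens.
Qed.

Lemma transposed_transpose_tens t x y f g : homog t g ->
  transposed (Hop a b c d) (tens x f) (tens y g) (transpose_tens x y f g).
Proof.
move=> hg s u us; rewrite !pairingDl; try exact: Omega_tens; last first.
  by apply: OmegaD; exact: Omega_tens.
rewrite !pairing_tens (fglift_deriv_op_tens _ _ us hg).
set u1 := fglift u _; set u2 := fglift u _; set u3 := fglift u _.
have [h2 h3] : homog (~~ s) u2 /\ homog (~~ s) u3 by split; exact: homog_fglift.
rewrite !mulrDl !tildeD -!mulrA -scalerAl tildeZ; congr (_ + _ + _).
  rewrite -mulrA (tilde_parts _ h2) scalerN scalerA -signr_addb addbN addbb.
  by rewrite expr1 scaleN1r opprK.
rewrite /= (tilde_parts _ (homog_D h3)) negbK (tilde_parts _ h3) scalerN opprK.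
rewrite scalerA -signr_addb addbN addbb expr1 scaleN1r mulrN.
by rewrite -[in RHS]scaleN1r tildeZ scaleN1r.
Qed.

(** Evaluating at an arbitrary v of V, rather than at a basis vector, makes the
coefficient identities available for all vectors at once. *)
Lemma jacL_tens s t x y f g (v : V) : homog s f -> homog t g ->
  fglift (jacL (Hop a b c d) s t (tens x f) (tens y g) (transpose_tens x y f g)) v =
  jacobiator D field (bilin_form a) (bilin_op b) (bilin_op c) (bilin_op d)
    s t v x y f g.
Proof.
move=> hf hg; have Ob := Omega_tens.
have [if_ ig] := (inL_image (Hop a b c d) (inL_tens x hf),
  inL_image (Hop a b c d) (inL_tens y hg)).
have h1 : homog (t (+) s) (iter 2 D g * f).
  by apply: homogM => //; exact: (homog_iterD 2 hg).
have h2 : homog (~~ (~~ t (+) s)) (D (D g * f)).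
  by apply: homog_D; apply: homogM => //; exact: homog_D.
have h3 : homog (t (+) s) (- iter 2 D (g * f)).
  by apply: homogN; exact: (homog_iterD 2 (homogM hg hf)).
have entryN z w h : entry z w (- h) = - entry z w h.
  by rewrite -scaleN1r /entry op_entryZ ?scaleN1r//; exact: DZ.
have HT : fglift (Hf (transpose_tens x y f g)) v =
    entry v (x *b y) (iter 2 D g * f) + entry v (x *c y) (D (D g * f))
    - entry v (x *d y) (iter 2 D (g * f)).
  rewrite /transpose_tens mdo_funD; try exact: Omega_tens; last first.
    by apply: OmegaD; exact: Omega_tens.
  rewrite mdo_funD; try exact: Omega_tens.
  rewrite !fglift_addl (fglift_Hop _ _ h1) (fglift_Hop _ _ h2).
  by rewrite (fglift_Hop _ _ h3) entryN.
have comb (X Y Z : L) (r : R) :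
    fglift (X - r *: Y + r *: Z) v =
    fglift X v - r *: fglift Y v + r *: fglift Z v.
  rewrite -[- (r *: Y)]scaleNr -scaleNr -!fglift_scalel -fglift_addl.
  by rewrite -fglift_addl.
rewrite /jacL comb HT.
rewrite (fglift_deriv_op_tens _ _ if_ hg) (fglift_deriv_op_tens _ _ ig hf).
have Ef (w : V) := fglift_Hop x w hf; have Eg (w : V) := fglift_Hop y w hg.
move: (Hf (tens x f)) Ef {if_} => Uf Ef.
move: (Hf (tens y g)) Eg {ig} => Ug Eg.
by rewrite !Ef !Eg mulnb.
Qed.

End TheOperator.

(** * Coefficient identities and NX-bialgebras *)

Section Algebra.
Variables (R : realType) (I : choiceType).
Variables (a : I -> I -> R) (b c d : I -> I -> I -> R).
Local Notation V := {freeg I / R}.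
Implicit Types (v x y z w : V).
Local Notation "x '*b' y" := (bilin_op b x y) (at level 40).
Local Notation "x '*c' y" := (bilin_op c x y) (at level 40).
Local Notation "x '*d' y" := (bilin_op d x y) (at level 40).
Local Notation "<| x , y |>" := (bilin_form a x y).
Local Notation coefV := (jac_coefV (bilin_op b) (bilin_op c) (bilin_op d)).
Local Notation coefR := (jac_coefR (bilin_form a) (bilin_op b) (bilin_op c) (bilin_op d)).

Lemma bilin_op_oppl m x y : bilin_op m (- x) y = - bilin_op m x y :> V.
Proof. by rewrite -scaleN1r bilin_op_scalel scaleN1r. Qed.
Lemma bilin_op_oppr m x y : bilin_op m x (- y) = - bilin_op m x y :> V.
Proof. by rewrite -scaleN1r bilin_op_scaler scaleN1r. Qed.
Lemma bilin_form_oppl x y : <| - x, y |> = - <| x, y |>.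
Proof. by rewrite -scaleN1r bilin_form_scalel mulN1r. Qed.
Lemma bilin_form_oppr x y : <| x, - y |> = - <| x, y |>.
Proof. by rewrite -scaleN1r bilin_form_scaler mulN1r. Qed.

Definition bilinE := (@bilin_op_addl R I, @bilin_op_addr R I, bilin_op_oppl,
  bilin_op_oppr).
Definition bilin_formDN := (@bilin_form_addl R I a, @bilin_form_addr R I a,
  bilin_form_oppl, bilin_form_oppr).

Hypothesis times_comm : commutative (bilin_op c).
Hypothesis dotE : forall x y, x *b y = x *d y + y *d x - x *c y.
Hypothesis form_sym : forall x y, <| x, y |> = <| y, x |>.

(** The coefficient of f g gives right commutativity, that of f Dg the compatibility of
the two products, and those of Df Dg and Df D^3 g the last two axioms; f D^2 g then
gives left symmetry. *)
Lemma NX_of_coefs :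
  (forall j k v x y, (j + k <= 4)%N -> coefV j k v x y = 0) ->
  NX_bialgebra (bilin_op c) (bilin_op d).
Proof.
move=> W.
have W00 v x y : (v *d y) *d x = (v *d x) *d y.
  by apply/eqP; rewrite -subr_eq0; apply/eqP/(W 0 0)%N.
have W01 v x y : (v *c y) *d x = (v *d x) *c y.
  by apply/eqP; rewrite -subr_eq0; apply/eqP/(W 0 1)%N.
split.
- by split; [exact: bilin_op_bilinear | exact: times_comm].
- split; [exact: bilin_op_bilinear | by move=> *; exact: W00 |].
  move=> x y z; apply/eqP/freeg_eqP => i.
  have /(congr1 (coeff i)) := W 0%N 2%N x z y isT.
  rewrite /= !dotE !bilinE !(W01 x z y) (W00 x z y) !(coeffD, coeffN, coeff0).
  lra.
- by move=> u v w; rewrite times_comm W01 times_comm.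
- move=> u v w; apply/eqP/freeg_eqP => i.
  have /(congr1 (coeff i)) := W 1%N 1%N v u w isT.
  rewrite /= !W01 [u *c v]times_comm [u *c (v *c w)]times_comm.
  rewrite [u *c (v *d w)]times_comm !(coeffD, coeffN, coeff0).
  lra.
- move=> u v w; apply/eqP/freeg_eqP => i.
  have /(congr1 (coeff i)) := W 1%N 3%N u v w isT.
  rewrite /= !dotE !(coeffD, coeffN, coeff0); lra.
Qed.

(** The coefficient of f D^7 g gives <v, y o x> = <v o x, y>, and those of D^3 f D^4 g
and D^4 f D^3 g together give <v, x o y> = <v, y o x> = 2 <v, x * y>. *)
Lemma form_inv_of_coefs :
  (forall j k v x y, (j < 8)%N -> (k < 8)%N -> (4 < j + k)%N ->
    coefR j k v x y = 0) ->
  forall u v w, <| u *d v, w |> = <| u, v *d w |> /\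
    <| u, v *d w |> = 2 * <| u *c v, w |>.
Proof.
move=> W u v w.
have W07 x y z : <| x, z *d y |> = <| x *d y, z |>.
  have := W 0%N 7%N x y z isT isT isT; rewrite /= dotE !bilin_formDN; lra.
have W12 x y z : <| x, y *d z |> = <| x, z *d y |> /\
    <| x, y *d z |> = 2 * <| x, y *c z |>.
  have := W 3%N 4%N x y z isT isT isT; have := W 4%N 3%N x y z isT isT isT.
  by rewrite /= dotE !bilin_formDN; move=> *; split; lra.
have uvw : <| u *d v, w |> = <| u, v *d w |> by rewrite -W07 (W12 u w v).1.
by split=> //; rewrite -uvw form_sym (W12 w u v).2 form_sym.
Qed.

Section Converse.
Hypothesis NX : NX_bialgebra (bilin_op c) (bilin_op d).
Hypothesis form_inv : forall u v w, <| u *d v, w |> = <| u, v *d w |> /\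
    <| u, v *d w |> = 2 * <| u *c v, w |>.

(** Coordinatewise, each coefficient is a linear combination of instances of the axioms
at permutations of v, x, y, after commuting the products * into a normal form. *)
Lemma coefV_of_NX j k v x y : coefV j k v x y = 0.
Proof.
have [[_ _] [_ N1 N2] X1 X2 X3] := NX.
have coords (z z' : V) i : z = z' -> coeff i z = coeff i z' by move=> ->.
apply/eqP/freeg_eqP => i; rewrite coeff0.
have C1 := (fun x y z => coords _ _ i (N1 x y z)).
have C2 := (fun x y z => coords _ _ i (N2 x y z)).
have C3 := (fun x y z => coords _ _ i (X1 x y z)).
have C4 := (fun x y z => coords _ _ i (X2 x y z)).
have C5 := (fun x y z => coords _ _ i (X3 x y z)).
move: (C1 v x y) (C1 x v y) (C1 y v x) (C2 v x y) (C2 v y x) (C2 x y v)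
  (C3 v x y) (C3 v y x) (C3 x v y) (C3 x y v) (C3 y v x) (C3 y x v)
  (C4 v x y) (C4 v y x) (C4 x v y) (C4 x y v) (C4 y v x) (C4 y x v)
  (C5 v x y) (C5 v y x) (C5 x v y) (C5 x y v) (C5 y v x) (C5 y x v).
rewrite [x *c v]times_comm [y *c v]times_comm [y *c x]times_comm
  ![v *c (_ *d _)]times_comm ![x *c (_ *d _)]times_comm
  ![y *c (_ *d _)]times_comm ![v *c (_ *c _)]times_comm
  ![x *c (_ *c _)]times_comm ![y *c (_ *c _)]times_comm
  !(coeffD, coeffN) => *.
case: j k => [|[|[|[|[|j]]]]] [|[|[|[|[|k]]]]] /=; rewrite ?coeff0 //;
  rewrite ?dotE ?bilinE ?[x *c v]times_comm ?[y *c v]times_comm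
    ?[y *c x]times_comm ?[v *c (_ *d _)]times_comm ?[x *c (_ *d _)]times_comm
    ?[y *c (_ *d _)]times_comm ?[v *c (_ *c _)]times_comm
    ?[x *c (_ *c _)]times_comm ?[y *c (_ *c _)]times_comm
    !(coeffD, coeffN); lra.
Qed.

Lemma coefR_of_NX j k v x y : coefR j k v x y = 0.
Proof.
case: j k => [|[|[|[|[|[|[|[|j]]]]]]]] [|[|[|[|[|[|[|[|k]]]]]]]] //=;
  have [] := form_inv v x y; have [] := form_inv v y x;
  have [] := form_inv x v y; have [] := form_inv x y v;
  have [] := form_inv y v x; have [] := form_inv y x v;
  rewrite ?dotE ?bilin_formDN [x *c v]times_comm [y *c v]times_comm
    [y *c x]times_comm ![<| v, _ *d _ |>]form_sym ![<| x, _ *d _ |>]form_sym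
    ![<| y, _ *d _ |>]form_sym ?[<| v, _ *c _ |>]form_sym
    ?[<| x, _ *c _ |>]form_sym ?[<| y, _ *c _ |>]form_sym; lra.
Qed.

End Converse.
End Algebra.

(** * Super skew-symmetry *)

Section SkewSymmetry.
Variables (R : realType) (I : choiceType).
Variables (a : I -> I -> R) (b c d : I -> I -> I -> R).
Hypothesis hb : forall al be, finite_set [set ga | b al be ga != 0].
Hypothesis hc : forall al be, finite_set [set ga | c al be ga != 0].
Hypothesis hd : forall al be, finite_set [set ga | d al be ga != 0].
Local Notation A := (superalg R I).
Local Notation L := (I -> A).
Local Notation V := {freeg I / R}.
Local Notation D := (@D R I).
Local Notation "x '*b' y" := (bilin_op b x y) (at level 40).
Local Notation "x '*c' y" := (bilin_op c x y) (at level 40).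
Local Notation "x '*d' y" := (bilin_op d x y) (at level 40).
Local Notation "<| x , y |>" := (bilin_form a x y).
Local Notation H := (Hop a b c d).
Local Notation Hf := (mdo_fun (Hop a b c d)).
Local Notation entry := (entry a b c d).
Implicit Types (s t : bool) (u v xi eta : L) (x y z : V) (f g : A).

Lemma pairing_Hop_tens t x y f g : homog t g ->
  pairing (tens x f) (Hf (tens y g)) = tilde (entry x y g * f).
Proof. by move=> hg; rewrite pairing_tens (fglift_Hop a hb hc hd y x hg). Qed.

(** The entry at (x, y) of minus the super adjoint of H: the terms b and c feed into the
lowest coefficient when their derivatives are moved onto the product. *)
Definition adjoint_entry x y g : A :=
  <| y, x |> *: iter 5 D g + field 1 (y *b x) * iter 2 D g
  + field 2 (y *c x) * D g + field 3 (y *b x + y *c x - y *d x) * g.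

Lemma tilde_parts2 s f g : homog s f ->
  tilde (D (D f) * g) = - tilde (f * D (D g)).
Proof.
move=> hf; rewrite (tilde_parts _ (homog_D hf)) (tilde_parts _ hf) scalerN opprK.
by rewrite scalerA -signr_addb addNb addbb expr1 scaleN1r.
Qed.

Lemma D_D_mul f g : D (D (f * g)) = D (D f) * g + f * D (D g).
Proof.
apply: derDM; [exact: DD | exact: DMl | | exact: sgAK].
by move=> h; rewrite D_sgA opprK.
Qed.

Lemma tilde_entry_adjoint s t x y f g : homog s f -> homog t g ->
  tilde (entry y x f * g) =
  - ((-1) ^+ (s && t) *: tilde (adjoint_entry x y g * f)).
Proof.
move=> hf hg; rewrite /entry /op_entry /adjoint_entry.
set w1 := y *b x; set w2 := y *c x; set w3 := y *d x; set r := <| y, x |>.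
have h1 := homog_field w1 (ltn0Sn 0); have h2 := homog_field w2 (ltn0Sn 1).
have h3 := homog_field w3 (ltn0Sn 2).
have swap s' t' (h k : A) : homog s' h -> homog t' k ->
    h * k = (-1) ^+ (s' && t') *: (k * h) by exact: supercomm.
have T5 : tilde (r *: iter 5 D f * g) =
    - ((-1) ^+ (s && t) *: tilde (r *: iter 5 D g * f)).
  rewrite -!scalerAl !tildeZ /= (tilde_parts2 _ (homog_iterD 3 hf)).
  rewrite (tilde_parts2 _ (homog_D hf)) opprK (tilde_parts _ hf).
  rewrite (swap _ _ _ _ hf (homog_iterD 5 hg)) tildeZ /=.
  rewrite scalerN !scalerA [in RHS]mulrC -!scalerA; congr (- (_ *: _)).
  by rewrite scalerA -signr_addb; congr (_ *: _); case: (s) (t) => [] [].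
have T1 : tilde (field 1 w1 * iter 2 D f * g) =
    - ((-1) ^+ (s && t) *: tilde ((field 3 w1 * g + field 1 w1 * iter 2 D g) * f)).
  rewrite (swap _ _ _ _ h1 (homog_iterD 2 hf)) /= -scalerAl tildeZ -mulrA.
  rewrite (tilde_parts2 _ hf) D_D_mul !D_field//.
  have hh : homog (~~ t) (field 3 w1 * g + field 1 w1 * D (D g)).
    apply: homogD; first exact: (homogM (homog_field w1 (ltn0Sn 2)) hg).
    exact: (homogM h1 (homog_iterD 2 hg)).
  rewrite (swap _ _ _ _ hf hh) tildeZ scalerN scalerA -signr_addb.
  by congr (- (_ *: _)); case: (s) (t) => [] [].
have T2 : tilde (field 2 w2 * D f * g) =
    - ((-1) ^+ (s && t) *: tilde ((field 3 w2 * g + field 2 w2 * D g) * f)).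
  rewrite (swap _ _ _ _ h2 (homog_D hf)) /= scale1r -mulrA.
  rewrite (tilde_parts _ hf) (DM _ h2) scale1r !D_field//.
  have hh : homog (~~ t) (field 3 w2 * g + field 2 w2 * D g).
    apply: homogD; first exact: (homogM (homog_field w2 (ltn0Sn 2)) hg).
    exact: (homogM h2 (homog_D hg)).
  rewrite (swap _ _ _ _ hf hh) tildeZ scalerA -signr_addb.
  by congr (- (_ *: _)); case: (s) (t) => [] [].
have T3 : tilde (field 3 w3 * f * g) =
    (-1) ^+ (s && t) *: tilde (field 3 w3 * g * f).
  by rewrite -!mulrA (swap _ _ _ _ hf hg) -scalerAr tildeZ.
have tN h : tilde (- h) = - tilde h :> Atilde R I.
  by rewrite -scaleN1r tildeZ scaleN1r.
rewrite (mulrDl _ (field 3 w3 * f)) (mulrDl _ (field 2 w2 * D f)).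
rewrite (mulrDl _ (field 1 w1 * iter 2 D f)) !tildeD T5 T1 T2 T3.
rewrite !fieldD !fieldN !(mulrDl, mulNr) !tildeD !tN !scalerDr !scalerN.
rewrite !opprD opprK.
have collect (M : zmodType) (t1 t2 t3 t4 t5 t6 : M) :
    - t1 + (- t4 - t2) + (- t5 - t3) + t6 = - t1 - t2 - t3 + (- t4 - t5 + t6).
  by zmodule.
exact: collect.
Qed.

Lemma skew_of_adjoint :
  (forall x y g, entry x y g = adjoint_entry x y g) -> super_skew H.
Proof.
move=> adj s1 s2 xi1 xi2 O1 + O2.
rewrite -(negbK s1) -(negbK s2) => i1 i2.
move: (~~ s1) (~~ s2) i1 i2 => {}s1 {}s2 i1 i2.
rewrite !addbT !negbK mulnb.
move: xi1 O1 i1; apply: homog_ind_Omega.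
- by rewrite mdo_fun0 pairing0l pairing0r scaler0 oppr0.
- move=> xi xi' O O' _ _ IH IH'; rewrite pairingDl// mdo_funD// pairingDr//.
  by rewrite IH IH' scalerDr opprD.
move=> p f hf; move: xi2 O2 i2; apply: homog_ind_Omega.
- by rewrite mdo_fun0 pairing0l pairing0r scaler0 oppr0.
- have Op := Omega_tens << p >> f.
  move=> xi xi' O O' _ _ IH IH'; rewrite pairingDl// mdo_funD// pairingDr//.
  by rewrite IH IH' scalerDr opprD.
move=> q g hg; rewrite (pairing_Hop_tens _ _ _ hg) (pairing_Hop_tens _ _ _ hf).
rewrite (tilde_entry_adjoint _ _ hf hg) scalerN opprK scalerA -signr_addb addbb.
by rewrite scale1r adj.
Qed.

Lemma tilde_eq0 f : tilde f = 0 <-> exists z : A, f = D z.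
Proof. by rewrite -tilde0; split=> [/tildeP|h]; [|apply/tildeP]; rewrite subr0. Qed.

(** Even test functions h suffice, as Phi_i(N)^2 is even. *)
Lemma nondegenerate_tilde (i : I) f :
  (forall h, homog false h -> tilde (f * h) = 0) -> f = 0.
Proof.
move=> f0; apply: (@nondegenerate_square _ _ i) => N Nn; apply/tilde_eq0/f0.
have hP : homog (odd N.-1.+1) (Phi R i N) := homog_Phi R i (ltn0Sn N.-1).
by rewrite -[false](addbb (odd N.-1.+1)); exact: homogM.
Qed.

Lemma adjoint_of_skew (i : I) x y t g : super_skew H -> homog t g ->
  entry x y g = adjoint_entry x y g.
Proof.
move=> sk hg; apply/eqP; rewrite -subr_eq0; apply/eqP.
apply: (nondegenerate_tilde i) => h hh.
have := sk true (~~ t) (tens x h) (tens y g) (Omega_tens _ _)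
  (inL_tens x hh) (Omega_tens _ _) (inL_tens y hg).
rewrite (pairing_Hop_tens _ _ _ hg) (pairing_Hop_tens _ _ _ hh).
rewrite (tilde_entry_adjoint _ _ hh hg) scale1r expr0 scale1r opprK.
by rewrite mulrBl tildeD -mulNr => ->; rewrite -tildeD mulNr addrN tilde0.
Qed.

(** The operators of [adjoint_of_skew] agree on Phi_i(6), whose derivatives do not
occur in their coefficients. *)
Lemma relations_of_skew (i : I) x y : super_skew H ->
  [/\ <| x, y |> = <| y, x |>, x *b y = y *b x, x *c y = y *c x &
      x *d y = y *b x + y *c x - y *d x].
Proof.
move=> sk.
pose C k := match k with
  | 0%N => field 3 (x *d y - (y *b x + y *c x - y *d x))
  | 1%N => field 2 (x *c y - y *c x)
  | 2%N => field 1 (x *b y - y *b x)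
  | 5%N => (<| x, y |> - <| y, x |>)%:A
  | _ => 0 end.
have C0 : forall k, (k < 6)%N -> C k = 0.
  apply: (@diffop_coef0 _ _ i 6); first by [].
  - have O0 : order_le i 5 (0 : A) by move=> m _; rewrite dPhi0.
    case=> [|[|[|[|[|[|//]]]]]] _ //=.
    + by apply: (@order_le_mono _ _ _ 3) => //; exact: order_le_field.
    + by apply: (@order_le_mono _ _ _ 2) => //; exact: order_le_field.
    + by apply: (@order_le_mono _ _ _ 1) => //; exact: order_le_field.
    + by move=> m _; exact: dPhi_const.
  have := adjoint_of_skew i x y sk (homog_Phi R i (ltn0Sn 5)).
  move: (Phi R i 6) => g /eqP; rewrite -subr_eq0 => /eqP E.
  rewrite !big_ord_recl big_ord0 /= !mul0r !add0r addr0 -[RHS]E.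
  rewrite /entry /op_entry /adjoint_entry.
  rewrite ?(fieldD, fieldN) !scalerBl !(mulrBl, mulrDl) !mulr_algl.
  have collect (M : zmodType) (t0 t1 t2 t5 u0 u0' u0'' u1 u2 u5 : M) :
      t0 - (u0 + u0' - u0'') + (t1 - u1 + (t2 - u2 + (t5 - u5))) =
      t5 + t2 + t1 + t0 - (u5 + u2 + u1 + (u0 + u0' - u0'')) by zmodule.
  exact: collect.
have eq0 z w : z - w = 0 -> z = w by move=> /eqP; rewrite subr_eq0 => /eqP.
split.
- by apply/eqP; rewrite -subr_eq0; apply/eqP/(@scalar_inj R I)/(C0 5%N).
- exact/eq0/(@field_inj _ _ 1)/(C0 2%N).
- exact/eq0/(@field_inj _ _ 2)/(C0 1%N).
- exact/eq0/(@field_inj _ _ 3)/(C0 0%N).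
Qed.

End SkewSymmetry.

(** * The theorem *)

Section Main.
Variables (R : realType) (I : choiceType).
Variables (a : I -> I -> R) (b c d : I -> I -> I -> R).
Hypothesis hb : forall al be, finite_set [set ga | b al be ga != 0].
Hypothesis hc : forall al be, finite_set [set ga | c al be ga != 0].
Hypothesis hd : forall al be, finite_set [set ga | d al be ga != 0].
Local Notation A := (superalg R I).
Local Notation L := (I -> A).
Local Notation V := {freeg I / R}.
Local Notation D := (@D R I).
Local Notation "x '*b' y" := (bilin_op b x y) (at level 40).
Local Notation "x '*c' y" := (bilin_op c x y) (at level 40).
Local Notation "x '*d' y" := (bilin_op d x y) (at level 40).
Local Notation "<| x , y |>" := (bilin_form a x y).
Local Notation H := (Hop a b c d).
Local Notation Hf := (mdo_fun (Hop a b c d)).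
Local Notation entry := (entry a b c d).
Local Notation coefV := (jac_coefV (bilin_op b) (bilin_op c) (bilin_op d)).
Local Notation coefR := (jac_coefR (bilin_form a) (bilin_op b) (bilin_op c) (bilin_op d)).
Local Notation coef := (jac_coef (@field R I) (bilin_form a)
  (bilin_op b) (bilin_op c) (bilin_op d)).
Local Notation jacobiator := (jacobiator D (@field R I) (bilin_form a)
  (bilin_op b) (bilin_op c) (bilin_op d)).
Implicit Types (s t : bool) (u xi eta : L) (v x y z : V) (f g : A).

Lemma jacobiator_expand s t v x y f g : homog s f -> homog t g ->
  jacobiator s t v x y f g =
  \sum_(j < 8) \sum_(k < 8) coef s j k v x y * (iter j D f * iter k D g).
Proof.
move=> hf hg.
have sg_D (h : A) : sgA (D h) = - D (sgA h) by rewrite D_sgA opprK.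
have sgF n (w : V) : (0 < n)%N -> sgA (field n w) = (-1) ^+ odd n *: field n w.
  by move=> n0; exact: (sgA_homog (homog_field w n0)).
apply: (@jacobiator_seqE R A V (@sgA R I) D (@DD R I) (@DZ R I) (@DMl R I)
  (@field R I) (@fieldD R I) (@fieldN R I) (@D_field R I) sgF
  (bilin_form a) (bilin_op b) (bilin_op c) (bilin_op d) sg_D (@sgAK R I)
  s t (fun k => iter k D f) (fun k => iter k D g) v x y) => // [k|k|j k].
- by rewrite (sgA_homog (homog_iterD k hf)) addbC.
- by rewrite (sgA_homog (homog_iterD k hg)) addbC.
- rewrite (supercomm (homog_iterD k hg) (homog_iterD j hf)).
  by rewrite andbC ![odd _ (+) _]addbC.
Qed.

(** If all coefficients of the Jacobiator vanish, then [H xi, H eta] = H zeta for simple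
tensors, hence for all arguments, and d omega is the pairing with 0. *)
Lemma hamiltonian_of_coefs :
  (forall x y g, entry x y g = adjoint_entry a b c d x y g) ->
  (forall j k v x y, coefV j k v x y = 0) ->
  (forall j k v x y, coefR j k v x y = 0) -> hamiltonian H.
Proof.
move=> adj W0 W0'; have sk := skew_of_adjoint hb hc hd adj.
have sol : forall s2 s3 xi2 xi3, Omega xi2 -> inL (~~ s2) xi2 -> Omega xi3 ->
    inL (~~ s3) xi3 -> jacL_solvable H s2 s3 xi2 xi3.
  move=> s2 s3; apply: jacL_solvable_all => p q f g hf hg.
  exists (transpose_tens b c d << p >> << q >> f g); split.
  - exact: Omega_transpose_tens.
  - exact: inL_transpose_tens.
  - exact: transposed_transpose_tens hg.
  apply/funext => al; rewrite -[LHS](fgliftU _ al).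
  rewrite jacL_tens // jacobiator_expand // big1 // => j _; rewrite big1 // => k _.
  by rewrite /jac_coef W0 W0' field0 scale0r if_same scaler0 mul0r.
have sub := imH_subalgebra sol; split=> //.
move=> s1 s2 s3 x1 x2 x3 m1 h1 m2 h2 m3 h3.
have [xi1 [O1 i1 <-]] := imH_homog m1 h1.
have [xi2 [O2 i2 <-]] := imH_homog m2 h2.
have [xi3 [O3 i3 <-]] := imH_homog m3 h3.
have [eta [Oe ie te je]] := sol _ _ _ _ O2 i2 O3 i3.
have [_ _ _ br] := sub.
by rewrite (dform2_jacL sk br O1 i1 O2 i2 O3 i3 Oe ie te) je pairing0r
  scaler0 oppr0.
Qed.

(** Closedness and nondegeneracy annihilate the Jacobiator on the test functions
Phi_l(6) and Phi_l(14). The coefficients have order at most 5 and the derivatives of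
Phi_l(6) that occur have order at most 13, so [diffop_coef0] applies first to the
derivatives of Phi_l(14) and then to those of Phi_l(6). *)
Lemma coef_of_hamiltonian (l : I) v x y j k : hamiltonian H ->
  (j < 8)%N -> (k < 8)%N -> coef false j k v x y = 0.
Proof.
move=> [sk [_ _ _ br] cl] j8 k8.
have hf := homog_Phi R l (ltn0Sn 5); have hg := homog_Phi R l (ltn0Sn 13).
set f := Phi R l 6 in hf; set g := Phi R l 14 in hg.
have J0 : jacobiator false false v x y f g = 0.
  apply: (nondegenerate_tilde l) => h hh.
  rewrite -(jacL_tens a hb hc hd) // -pairing_tens.
  have [Ov iv] := (Omega_tens v h, inL_tens v hh).
  have [Ox ix] := (Omega_tens x f, inL_tens x hf).
  have [Oy iy] := (Omega_tens y g, inL_tens y hg).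
  have := dform2_jacL sk br Ov iv Ox ix Oy iy (Omega_transpose_tens b c d x y f g)
    (inL_transpose_tens b c d x y hf hg)
    (transposed_transpose_tens a hb hc hd x y f hg).
  rewrite cl; try exact: inL_image;
    try by [exists (tens v h) | exists (tens x f) | exists (tens y g)].
  by rewrite expr0 scale1r => /eqP; rewrite eq_sym oppr_eq0 => /eqP.
have ordC m n : order_le l 5 (coef false m n v x y).
  rewrite /jac_coef; apply: order_leZ; case: ifP => mn; last first.
    by move=> i _; exact: dPhi_const.
  apply: (@order_le_mono _ _ _ (5 - m - n)); first by lia.
  by apply: order_le_field; lia.
rewrite (jacobiator_expand _ _ _ hf hg) exchange_big /= in J0.
have K0 := @diffop_coef0 R I l 14 8
  (fun n => \sum_(m < 8) coef false m n v x y * iter m D f) isT.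
apply: (@diffop_coef0 R I l 6 8 (fun m => coef false m k v x y) isT) => //.
apply: (K0 _ _ k k8).
  move=> n _ m mn; rewrite dPhi_sum big1 // => -[i i8] _ /=.
  rewrite dPhiMl (ordC _ _ m) ?mul0r ?add0r; last by lia.
  by rewrite iterD_Phi // dPhi_Phi // (_ : (6 + i == m)%N = false) ?andbF ?mulr0 //; lia.
rewrite -[RHS]J0; apply: eq_bigr => n _; rewrite mulr_suml.
by apply: eq_bigr => m _; rewrite mulrA.
Qed.

End Main.

Theorem theorem3p1 (R : realType) (I : choiceType)
    (a : I -> I -> R) (b c d : I -> I -> I -> R)
    (hb : forall al be, finite_set [set ga | b al be ga != 0])
    (hc : forall al be, finite_set [set ga | c al be ga != 0])
    (hd : forall al be, finite_set [set ga | d al be ga != 0]) :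
  hamiltonian (Hop a b c d)
  <->
  [/\ NX_bialgebra (bilin_op c) (bilin_op d),
      (forall u v : {freeg I / R},
         bilin_op b u v = bilin_op d u v + bilin_op d v u - bilin_op c u v),
      (forall u v : {freeg I / R}, bilin_form a u v = bilin_form a v u) &
      (forall u v w : {freeg I / R},
         bilin_form a (bilin_op d u v) w = bilin_form a u (bilin_op d v w)
         /\ bilin_form a u (bilin_op d v w)
            = 2 * bilin_form a (bilin_op c u v) w)].
Proof.
split=> [ham | [NX dotE form_sym form_inv]]; last first.
  have [[_ cC] _ _ _ _] := NX.
  apply: hamiltonian_of_coefs => //.
  - move=> x y g; rewrite /adjoint_entry /entry /op_entry form_sym.
    congr (_ + _ * _ + _ * _ + _ * _); congr (field _ _); rewrite ?dotE.
    + by congr (_ - _); [exact: addrC | exact: cC].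
    + exact: cC.
    + by rewrite subrK [X in _ = X - _]addrC addrK.
  - exact: coefV_of_NX.
  - exact: coefR_of_NX.
(* The test functions need an index; if there is none, then V = 0. *)
have [[l _] | nI] := pselect (exists l : I, True); last first.
  have V0 (x : {freeg I / R}) : x = 0.
    by apply/eqP/freeg_eqP => i; case: nI; exists i.
  have Vtriv (x y : {freeg I / R}) : x = y by rewrite (V0 x) (V0 y).
  have F0 x y : bilin_form a x y = 0.
    by rewrite (V0 x) -(scale0r 0) bilin_form_scalel mul0r.
  split; try by move=> *; exact: Vtriv.
  - split; try by move=> *; exact: Vtriv.
      by split; [exact: bilin_op_bilinear | move=> *; exact: Vtriv].
    by split; [exact: bilin_op_bilinear | |]; move=> *; exact: Vtriv.
  - by move=> *; rewrite !F0.
  - by move=> *; rewrite !F0 mulr0.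
have [sk _ _] := ham.
have rel x y := relations_of_skew hb hc hd l x y sk.
have cC : commutative (bilin_op c) by move=> x y; have [] := rel x y.
have form_sym x y : bilin_form a x y = bilin_form a y x by have [] := rel x y.
have dotE x y : bilin_op b x y = bilin_op d x y + bilin_op d y x - bilin_op c x y.
  have [_ bC _ ->] := rel x y; rewrite bC subrK cC; zmodule.
have coef0 j k v x y := @coef_of_hamiltonian _ _ _ _ _ _ hb hc hd l v x y j k ham.
split=> //.
- apply: NX_of_coefs => // j k v x y jk.
  have := coef0 j k v x y; rewrite /jac_coef jk.
  rewrite expr0 scale1r => F0; apply: (@field_inj R I (5 - j - k)); first by lia.
  by apply: F0; lia.
- apply: form_inv_of_coefs => // j k v x y j8 k8 jk.
  have := coef0 j k v x y j8 k8; rewrite /jac_coef leqNgt jk /=.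
  by rewrite expr0 scale1r => /scalar_inj.
Qed.
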